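(* Let $G$ be a directed acyclic graph on $n$ nodes with maximum out-degree $d$ (e.g. an acyclic orientation of a graph of degeneracy $d$ witnessing its degeneracy), and let $P$ be a dag on $k$ nodes. Then $\hom(P,G)$ can be computed in time $f(d,k)\cdot\tilde{O}(n^{\tau(P)})$ for some computable function $f$.
   Context: $\hom(P,G)$ is the number of maps $V_P\to V_G$ sending each arc $(u,v)$ of $P$ to an arc $(\phi(u),\phi(v))$ of $G$. For a dag $P$: $S_P$ is its set of sources; $V_P(u)$ is the set of nodes reachable from $u$ (including $u$); $V_P(B)=\bigcup_{u\in B}V_P(u)$. A dag tree decomposition of $P$ is a rooted tree whose nodes (bags) are subsets of $S_P$ with union $S_P$, such that whenever bag $B$ lies on the tree path between bags $B_1,B_2$, $V_P(B_1)\cap V_P(B_2)\subseteq V_P(B)$; its width is the maximum bag size, and $\tau(P)$ is the minimum width over all dag tree decompositions of $P$. Conventions: $k=O(1)$; $\tilde O$ hides $\mathrm{poly}(k)$ and $\mathrm{polylog}(ndk)$ factors. *)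

(* Defs.v *)
From mathcomp Require Import all_boot.
From mathcomp.classical Require Import boolp.

Set Implicit Arguments.
Unset Strict Implicit.
Unset Printing Implicit Defensive.

(** * Directed graphs *)

Definition acyclic (V : finType) (e : rel V) : Prop :=
  forall c : seq V, cycle e c -> c = [::].

Definition max_outdeg (V : finType) (e : rel V) : nat :=
  \max_(u : V) #|[set v | e u v]|.

Definition hom (VP VG : finType) (P : rel VP) (G : rel VG) : nat :=
  #|[set phi : {ffun VP -> VG} |
      [forall u, forall v, P u v ==> G (phi u) (phi v)]]|.

Definition sources (V : finType) (e : rel V) : {set V} :=
  [set u | [forall v, ~~ e v u]].

Definition reach (V : finType) (e : rel V) (u : V) : {set V} :=
  [set v | connect e u v].

Definition reach_set (V : finType) (e : rel V) (B : {set V}) : {set V} :=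
  \bigcup_(u in B) reach e u.

(** * Dag tree decompositions *)

(* A tree with node set [N] and undirected adjacency [a]: connected, and
   without simple cycles.  For symmetric [a], [[:: x; y]] is a [ucycle] as soon
   as [a x y], hence the bound 2. *)
Definition is_tree (T : finType) (N : {set T}) (a : rel T) : Prop :=
  [/\ symmetric a,
      irreflexive a,
      forall x y, a x y -> (x \in N) && (y \in N),
      {in N &, forall x y, connect a x y}
    & forall c : seq T, ucycle a c -> size c <= 2].

Definition on_tree_path (T : finType) (a : rel T) (x y z : T) : Prop :=
  exists p : seq T,
    [/\ path a x p, uniq (x :: p), last x p = y & z \in x :: p].

Record dag_tree_decomposition (V : finType) (e : rel V) :=
  DagTreeDecomposition {
    bags : {set {set V}};
    root : {set V};
    adj : rel {set V};
    _ : is_tree bags adj;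
    _ : root \in bags;
    _ : forall B, B \in bags -> B \subset sources e;
    _ : \bigcup_(B in bags) B = sources e;
    _ : forall B B1 B2, B1 \in bags -> B2 \in bags ->
          on_tree_path adj B1 B2 B ->
          reach_set e B1 :&: reach_set e B2 \subset reach_set e B
  }.

Definition width (V : finType) (e : rel V) (D : dag_tree_decomposition e) :
  nat := \max_(B in bags D) #|B|.

Lemma single_bag_exists (V : finType) (e : rel V) :
  exists w, `[< exists D : dag_tree_decomposition e, width D = w >].
Proof.
suff D : dag_tree_decomposition e.
  by exists (width D); apply/asboolP; exists D.
apply: (@DagTreeDecomposition V e [set sources e] (sources e)
          (fun _ _ => false)).
- split=> //.
  + by move=> x y /set1P-> /set1P->; apply: connect0.
  + by case=> [|x [|y c]].
- exact: set11.
- by move=> B /set1P->.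
- by rewrite big_set1.
- move=> B B1 B2 /set1P-> /set1P-> [[|y p] [//= _ _ _]].
  by rewrite inE => /eqP->; rewrite setIid.
Qed.

Definition tau (V : finType) (e : rel V) : nat := ex_minn (single_bag_exists e).

(** * Random access machines with logarithmic cost *)

(* Structured programs over finitely many unbounded arrays of natural numbers.
   Array names are fixed by the program text, indices are computed; a scalar
   variable is cell 0 of some array. *)
Inductive expr : Type :=
| Const of nat
| Get of nat & expr
| Add of expr & expr
| Sub of expr & expr
| Mul of expr & expr
| Div of expr & expr.

Inductive prog : Type :=
| Skip
| Set_ of nat & expr & expr
| Seq of prog & prog
| If of expr & prog & prog
| While of expr & prog.

Definition state := nat -> nat -> nat.

Definition update (s : state) (a i x : nat) : state :=
  fun b j => if (b == a) && (j == i) then x else s b j.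

Fixpoint eval (s : state) (e : expr) : nat :=
  match e with
  | Const x => x
  | Get a e1 => s a (eval s e1)
  | Add e1 e2 => eval s e1 + eval s e2
  | Sub e1 e2 => eval s e1 - eval s e2
  | Mul e1 e2 => eval s e1 * eval s e2
  | Div e1 e2 => eval s e1 %/ eval s e2
  end.

Definition bits (x : nat) : nat := (trunc_log 2 x).+1.

(* Logarithmic cost criterion: an operation is charged the number of bits of
   its operands, and a memory access the number of bits of the address and of
   the content. *)
Fixpoint cost (s : state) (e : expr) : nat :=
  match e with
  | Const x => bits x
  | Get a e1 => cost s e1 + bits (eval s e1) + bits (s a (eval s e1))
  | Add e1 e2 | Sub e1 e2 | Mul e1 e2 | Div e1 e2 =>
      cost s e1 + cost s e2 + bits (eval s e1) + bits (eval s e2)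
  end.

(* [exec c s s' t]: started in state [s], program [c] halts in state [s'] after
   time [t].  Tests succeed on nonzero values. *)
Inductive exec : prog -> state -> state -> nat -> Prop :=
| exec_skip s : exec Skip s s 1
| exec_set s a e1 e2 :
    exec (Set_ a e1 e2) s (update s a (eval s e1) (eval s e2))
      (cost s e1 + cost s e2 + bits (eval s e1) + bits (eval s e2))
| exec_seq s s1 s2 c1 c2 t1 t2 :
    exec c1 s s1 t1 -> exec c2 s1 s2 t2 -> exec (Seq c1 c2) s s2 (t1 + t2)
| exec_if_true s s1 e c1 c2 t :
    eval s e != 0 -> exec c1 s s1 t -> exec (If e c1 c2) s s1 (cost s e + t)
| exec_if_false s s1 e c1 c2 t :
    eval s e = 0 -> exec c2 s s1 t -> exec (If e c1 c2) s s1 (cost s e + t)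
| exec_while_true s s1 s2 e c t1 t2 :
    eval s e != 0 -> exec c s s1 t1 -> exec (While e c) s1 s2 t2 ->
    exec (While e c) s s2 (cost s e + t1 + t2)
| exec_while_false s e c :
    eval s e = 0 -> exec (While e c) s s (cost s e).

(* The input is stored in array 0 and all other cells are 0; the output is read
   from cell 0 of array 1. *)
Definition init (input : seq nat) : state :=
  fun a i => if a == 0 then nth 0 input i else 0.

Definition outputs_in (c : prog) (input : seq nat) (y t : nat) : Prop :=
  exists2 s : state, exec c (init input) s t & s 1 0 = y.

Definition computes_within (c : prog) (input : seq nat) (y T : nat) : Prop :=
  exists2 t : nat, outputs_in c input y t & t <= T.

Definition computable2 (f : nat -> nat -> nat) : Prop :=
  exists c : prog, forall x y : nat,
    exists t : nat, outputs_in c [:: x; y] (f x y) t.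

(* Adjacency lists: the number of nodes, then for each node its out-degree
   followed by its out-neighbours. *)
Definition encode (n : nat) (e : rel 'I_n) : seq nat :=
  n :: flatten [seq #|[set v | e u v]| ::
                    [seq nat_of_ord v | v <- enum 'I_n & e u v]
               | u <- enum 'I_n].

(** * Soft-O *)

(* The bound [c * poly(k) * polylog(n d k) * x]; the successors keep the
   hidden factors positive when n, d or k is 0. *)
Definition soft_bound (c n d k x : nat) : nat :=
  c * k.+1 ^ c * bits (n.+1 * d.+1 * k.+1) ^ c * x.

(* Main.v *)
(* A dag tree decomposition yields an ordered list of out-closed node sets
   V(B_1), ..., V(B_m) of P, each with an earlier parent containing its
   intersection with all the earlier sets; its width bounds the number of nodes
   of each V(B_i) whose image must be guessed freely, all other images being
   out-neighbours of an image already known.  Such a list is described by a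
   number bounded in terms of k, so the machine can find one of minimal width by
   exhaustive search.  Going through the list backwards, it enumerates the at
   most n^tau (d+1)^k homomorphisms from V(B_i) to G and adds up, for each
   restriction to the parent set, the products of the sums already obtained for
   the children of B_i.  Tables are indexed by numbers coding partial maps,
   which have polylog(n) bits, so that a look-up is cheap in the logarithmic
   cost model. *)
Require Import Defs.
From mathcomp Require Import all_boot zify.

Set Implicit Arguments.
Unset Strict Implicit.
Unset Printing Implicit Defensive.

(** Time is measured on the machine itself, so the algorithm must exist as a program. It is written
    in a small language of total terms and bounded loops, whose meaning is a function and whose cost
    is bounded from its text: a number of instructions times a multiple of the bit length of the
    largest number. Loops whose length is bounded in terms of [d] and [k] may be nested freely;
    loops whose length may depend on [n] are never nested in each other, so that their bound [W],
    essentially [n ^ tau P], enters the time only once. All numbers stay below a power of [n + 2]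
    whose exponent depends on [d] and [k] only, whence a single logarithmic factor. What depends
    only on [d] and [k] is dominated by a tower of twos, which is easily computed; crude bounds
    therefore do no harm. Counting set by set is correct because homomorphisms on two out-closed
    sets that agree on the intersection glue together. *)

Inductive binop : Type := Plus | Minus | Times | Over.

Inductive term : Type :=
| Cst of nat
| Var of nat
| Cell of nat & term
| Op of binop & term & term
| Cond of term & term & term
| Big of bool & term & term.

(* The flag of [For] marks the loops whose length may depend on [n]. *)
Inductive stmt : Type :=
| Asg of nat & term & term
| Sq of stmt & stmt
| For of bool & term & stmt.

Definition op_fun (o : binop) : nat -> nat -> nat :=
  match o with
  | Plus => addn | Minus => subn | Times => muln | Over => divn
  end.

Definition big_val (b : bool) (N : nat) (F : nat -> nat) : nat :=
  if b then \prod_(0 <= i < N) F i else \sum_(0 <= i < N) F i.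

Fixpoint ev (e : term) (rho : seq nat) (s : state) : nat :=
  match e with
  | Cst x => x
  | Var x => nth 0 rho x
  | Cell a e1 => s a (ev e1 rho s)
  | Op o e1 e2 => op_fun o (ev e1 rho s) (ev e2 rho s)
  | Cond e0 e1 e2 => if ev e0 rho s == 0 then ev e2 rho s else ev e1 rho s
  | Big b e0 e1 => big_val b (ev e0 rho s) (fun i => ev e1 (i :: rho) s)
  end.

Fixpoint run (c : stmt) (rho : seq nat) (s : state) : state :=
  match c with
  | Asg a e1 e2 => update s a (ev e1 rho s) (ev e2 rho s)
  | Sq c1 c2 => run c2 rho (run c1 rho s)
  | For _ e c1 => iteri (ev e rho s) (fun i => run c1 (i :: rho)) s
  end.

(** * Size conditions on runs, and proofs by loop invariants *)

Section Safety.

Variables R W B : nat.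

(** [R] bounds the lengths that depend on [d] and [k] alone, [W] those that may depend on [n], [B]
    the values written to memory. Intermediate values carry no condition: they are bounded
    afterwards through [height_term]. *)
Fixpoint safe_term (e : term) (rho : seq nat) (s : state) : Prop :=
  match e with
  | Cst _ | Var _ => True
  | Cell _ e1 => safe_term e1 rho s
  | Op _ e1 e2 => safe_term e1 rho s /\ safe_term e2 rho s
  | Cond e0 e1 e2 =>
      [/\ safe_term e0 rho s, safe_term e1 rho s & safe_term e2 rho s]
  | Big _ e0 e1 =>
      [/\ safe_term e0 rho s, ev e0 rho s <= R
        & forall i, i < ev e0 rho s -> safe_term e1 (i :: rho) s]
  end.

Fixpoint safe (c : stmt) (rho : seq nat) (s : state) : Prop :=
  match c with
  | Asg _ e1 e2 =>
      [/\ safe_term e1 rho s, safe_term e2 rho s & ev e2 rho s <= B]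
  | Sq c1 c2 => safe c1 rho s /\ safe c2 rho (run c1 rho s)
  | For big e c1 =>
      [/\ safe_term e rho s, ev e rho s <= (if big then W else R)
        & forall i, i < ev e rho s ->
            safe c1 (i :: rho) (iteri i (fun j => run c1 (j :: rho)) s)]
  end.

(** Since [run] is total, termination needs no proof; one pass of reasoning yields both the
    postcondition and the size conditions from which the time bound follows. *)
Definition wp (c : stmt) (rho : seq nat) (s : state) (Q : state -> Prop) :=
  safe c rho s /\ Q (run c rho s).

Lemma wp_asg a e1 e2 rho s (Q : state -> Prop) :
  safe_term e1 rho s -> safe_term e2 rho s -> ev e2 rho s <= B ->
  Q (update s a (ev e1 rho s) (ev e2 rho s)) -> wp (Asg a e1 e2) rho s Q.
Proof. by []. Qed.

Lemma wp_seq c1 c2 rho s Q :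
  wp c1 rho s (fun s1 => wp c2 rho s1 Q) -> wp (Sq c1 c2) rho s Q.
Proof. by case=> ? [? ?]. Qed.

Lemma wp_mono c rho s (Q Q' : state -> Prop) :
  wp c rho s Q -> (forall s', Q s' -> Q' s') -> wp c rho s Q'.
Proof. by case=> ? ? ?; split; auto. Qed.

Lemma wp_for big e c rho s (I : nat -> state -> Prop) (Q : state -> Prop) :
  safe_term e rho s -> ev e rho s <= (if big then W else R) ->
  I 0 s ->
  (forall i s', i < ev e rho s -> I i s' -> wp c (i :: rho) s' (I i.+1)) ->
  (forall s', I (ev e rho s) s' -> Q s') ->
  wp (For big e c) rho s Q.
Proof.
move=> se le I0 IS IQ.
have H i : i <= ev e rho s -> I i (iteri i (fun j => run c (j :: rho)) s).
  by elim: i => [|i IH] // lti; have [] := IS _ _ lti (IH (ltnW lti)).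
split; last exact/IQ/H.
split=> // i lti.
by have [] := IS _ _ lti (H _ (ltnW lti)).
Qed.

End Safety.

Fixpoint writes (c : stmt) : seq nat :=
  match c with
  | Asg a _ _ => [:: a]
  | Sq c1 c2 => writes c1 ++ writes c2
  | For _ _ c1 => writes c1
  end.

Lemma run_frame c rho s a : a \notin writes c -> run c rho s a = s a.
Proof.
elim: c rho s => [b e1 e2|c1 IH1 c2 IH2|b e c IH] rho s /=.
- by rewrite inE /update => /negPf->.
- by rewrite mem_cat negb_or => /andP[n1 n2]; rewrite IH2 // IH1.
- by move=> na; elim: (ev e rho s) => //= i <-; rewrite IH.
Qed.

Lemma wp_frame R W B c rho s Q :
  wp R W B c rho s Q ->
  wp R W B c rho s
    (fun s' => Q s' /\ forall a, a \notin writes c -> s' a = s a).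
Proof. by case=> sf q; split=> //; split=> // a; apply: run_frame. Qed.

(** * Compilation *)

Arguments bits : simpl never.

(* Temporaries and loop counters live in array 2, allocated as a stack. *)
Definition tmp (l : nat) : expr := Get 2 (Const l).

Definition op_expr (o : binop) : expr -> expr -> expr :=
  match o with
  | Plus => Add | Minus => Defs.Sub | Times => Mul | Over => Div
  end.

Definition set_tmp (l : nat) (e : expr) : prog := Set_ 2 (Const l) e.

(** [env] lists the cells holding the loop counters, innermost first. The result lands in cell [l]
    and the temporaries below [l] are preserved. A loop keeps its length, counter and accumulator in
    [l], [l.+1] and [l.+2]; the truncated difference of the first two is nonzero exactly while
    rounds remain. *)
Fixpoint compile_term (env : seq nat) (l : nat) (e : term) : prog :=
  match e with
  | Cst x => set_tmp l (Const x)
  | Var x =>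
      set_tmp l (if x < size env then tmp (nth 0 env x) else Const 0)
  | Cell a e1 => Seq (compile_term env l e1) (set_tmp l (Get a (tmp l)))
  | Op o e1 e2 =>
      Seq (compile_term env l e1) (Seq (compile_term env l.+1 e2)
        (set_tmp l (op_expr o (tmp l) (tmp l.+1))))
  | Cond e0 e1 e2 =>
      Seq (compile_term env l e0)
        (If (tmp l) (compile_term env l e1) (compile_term env l e2))
  | Big b e0 e1 =>
      Seq (compile_term env l e0)
        (Seq (set_tmp l.+1 (Const 0))
          (Seq (set_tmp l.+2 (Const b))
            (Seq
              (While (Defs.Sub (tmp l) (tmp l.+1))
                (Seq (compile_term (l.+1 :: env) l.+3 e1)
                  (Seq (set_tmp l.+2 (op_expr (if b then Times else Plus)
                                        (tmp l.+2) (tmp l.+3)))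
                    (set_tmp l.+1 (Add (tmp l.+1) (Const 1))))))
              (set_tmp l (tmp l.+2)))))
  end.

Fixpoint compile (env : seq nat) (l : nat) (c : stmt) : prog :=
  match c with
  | Asg a e1 e2 =>
      Seq (compile_term env l e1)
        (Seq (compile_term env l.+1 e2) (Set_ a (tmp l) (tmp l.+1)))
  | Sq c1 c2 => Seq (compile env l c1) (compile env l c2)
  | For _ e c1 =>
      Seq (compile_term env l e)
        (Seq (set_tmp l.+1 (Const 0))
          (While (Defs.Sub (tmp l) (tmp l.+1))
            (Seq (compile (l.+1 :: env) l.+2 c1)
              (set_tmp l.+1 (Add (tmp l.+1) (Const 1))))))
  end.

(* Every term evaluates to at most [B ^ height_term R e], [B >= 2] being a
   bound on the memory contents; heights also bound stack depths and
   constants. *)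
Fixpoint height_term (R : nat) (e : term) : nat :=
  match e with
  | Cst x => x.+1
  | Var _ => 1
  | Cell _ e1 => (height_term R e1).+1
  | Op _ e1 e2 => (height_term R e1 + height_term R e2).+1
  | Cond e0 e1 e2 => height_term R e0 + height_term R e1 + height_term R e2
  | Big _ e0 e1 => (height_term R e0 + R.+1 * height_term R e1 + R).+3
  end.

Fixpoint height (R : nat) (c : stmt) : nat :=
  match c with
  | Asg _ e1 e2 => (height_term R e1 + height_term R e2).+1
  | Sq c1 c2 => height R c1 + height R c2
  | For _ e c1 => (height_term R e + height R c1).+2
  end.

(** Assignments and tests, each to be charged one unit. For a loop, 4 stands for the two
    initialisations, the failing test and the final copy, 3 for the test and the two assignments of
    a round. *)
Fixpoint steps_term (R : nat) (e : term) : nat :=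
  match e with
  | Cst _ | Var _ => 1
  | Cell _ e1 => (steps_term R e1).+1
  | Op _ e1 e2 => (steps_term R e1 + steps_term R e2).+1
  | Cond e0 e1 e2 => (steps_term R e0 + steps_term R e1 + steps_term R e2).+1
  | Big _ e0 e1 => steps_term R e0 + 4 + R * (steps_term R e1 + 3)
  end.

Fixpoint steps (R W : nat) (c : stmt) : nat :=
  match c with
  | Asg _ e1 e2 => (steps_term R e1 + steps_term R e2).+1
  | Sq c1 c2 => steps R W c1 + steps R W c2
  | For big e c1 =>
      steps_term R e + 2 + (if big then W else R) * (steps R W c1 + 2)
  end.

Fixpoint wf_term (e : term) : bool :=
  match e with
  | Cst _ | Var _ => true
  | Cell a e1 => (a != 2) && wf_term e1
  | Op _ e1 e2 => wf_term e1 && wf_term e2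
  | Cond e0 e1 e2 => [&& wf_term e0, wf_term e1 & wf_term e2]
  | Big _ e0 e1 => wf_term e0 && wf_term e1
  end.

Fixpoint wf (c : stmt) : bool :=
  match c with
  | Asg a e1 e2 => [&& a != 2, wf_term e1 & wf_term e2]
  | Sq c1 c2 => wf c1 && wf c2
  | For _ e c1 => wf_term e && wf c1
  end.

Lemma leq_bits x y : x <= y -> bits x <= bits y.
Proof. by move=> le; rewrite ltnS leq_trunc_log. Qed.

Lemma bits_gt0 x : 0 < bits x. Proof. by []. Qed.

Lemma bits_leP x c : 0 < c -> (bits x <= c) = (x < 2 ^ c).
Proof.
move=> c0; rewrite /bits; case: x => [|x].
  by rewrite trunc_log0 c0 expn_gt0.
apply/idP/idP => [lt|lt].
  by apply: leq_trans (trunc_log_ltn x.+1 (isT : 1 < 2)) _; rewrite leq_exp2l.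
by rewrite -(ltn_exp2l _ _ (isT : 1 < 2)) (leq_ltn_trans _ lt) // trunc_logP.
Qed.

Lemma ltn_2bits x : x < 2 ^ bits x.
Proof. by rewrite -bits_leP. Qed.

Lemma bits_exp x q : 0 < q -> bits (x ^ q) <= q * bits x.
Proof.
move=> q0; rewrite bits_leP ?muln_gt0 ?q0 // mulnC expnM ltn_exp2r //.
exact: ltn_2bits.
Qed.

Lemma big_valS b N F :
  big_val b N.+1 F = op_fun (if b then Times else Plus) (big_val b N F) (F N).
Proof. by case: b; rewrite /big_val big_nat_recr. Qed.

Lemma big_val0 b F : big_val b 0 F = b.
Proof. by case: b; rewrite /big_val big_geq. Qed.

Section Correctness.

Variables R W B h : nat.
Hypotheses (B_ge2 : 1 < B) (R_le : R <= B) (W_le : W <= B).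

Let V := B ^ h.
(** One unit pays for any emitted instruction: reading a temporary costs at most [3 * bits V], a
    binary operation on two of them [8 * bits V], and storing the result three more bit lengths; 20
    leaves slack. *)
Let unit_cost := 20 * bits V.

Definition bounded_state (s : state) := forall a i, a != 2 -> s a i <= B.

Lemma leq_expB m p : m <= p -> B ^ m <= B ^ p.
Proof. by move=> le; rewrite leq_exp2l. Qed.

Lemma ltn_expB m : m < B ^ m.
Proof. exact: ltn_expl. Qed.

Lemma expB_gt0 m : 0 < B ^ m.
Proof. by rewrite expn_gt0 ltnW. Qed.

(** Both summands are at most [B ^ (m + p)], and one more power absorbs the factor 2 because
    [B >= 2]. Hence an operation adds one to the height. *)
Lemma addB_le x y m p : x <= B ^ m -> y <= B ^ p -> x + y <= B ^ (m + p).+1.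
Proof.
move=> lx ly; rewrite expnS.
have l1 : x <= B ^ (m + p) by apply: leq_trans lx (leq_expB _); lia.
have l2 : y <= B ^ (m + p) by apply: leq_trans ly (leq_expB _); lia.
by nia.
Qed.

Lemma mulB_le x y m p : x <= B ^ m -> y <= B ^ p -> x * y <= B ^ (m + p).
Proof. by move=> lx ly; rewrite expnD leq_mul. Qed.

Lemma op_le o x y m p :
  x <= B ^ m -> y <= B ^ p -> op_fun o x y <= B ^ (m + p).+1.
Proof.
move=> lx ly; case: o => /=.
- exact: addB_le.
- apply: leq_trans (leq_subr _ _) _; apply: leq_trans lx (leq_expB _); lia.
- by apply: leq_trans (mulB_le lx ly) (leq_expB _).
- apply: leq_trans (leq_div _ _) _; apply: leq_trans lx (leq_expB _); lia.
Qed.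

(** One exponent serves both operators: a product is at most [B ^ (R * m)], a sum at most
    [R * B ^ m], and [R <= B ^ R]. *)
Lemma big_val_le b N F m :
  N <= R -> (forall i, i < N -> F i <= B ^ m) ->
  big_val b N F <= B ^ (R.+1 * m + R).
Proof.
move=> leN leF; case: b; rewrite /big_val.
  apply: leq_trans (_ : \prod_(0 <= i < N) B ^ m <= _).
    rewrite !big_mkord; apply: leq_prod => i _; exact/leF/ltn_ord.
  rewrite prod_nat_const_nat subn0 -expnM; apply: leq_expB; nia.
apply: leq_trans (_ : \sum_(0 <= i < N) B ^ m <= _).
  rewrite !big_mkord; apply: leq_sum => i _; exact/leF/ltn_ord.
rewrite sum_nat_const_nat subn0.
apply: leq_trans (_ : B ^ R * B ^ m <= _).
  by rewrite leq_mul2r (leq_trans leN) ?orbT // ltnW // ltn_expB.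
by rewrite -expnD; apply: leq_expB; nia.
Qed.

Lemma ev_le e rho s :
  bounded_state s -> wf_term e -> all (leq^~ B) rho -> safe_term R e rho s ->
  ev e rho s <= B ^ height_term R e.
Proof.
move=> bs; elim: e rho => [x|x|a e IH|o e1 IH1 e2 IH2|e0 IH0 e1 IH1 e2 IH2
    |b e0 IH0 e1 IH1] rho /=.
- by rewrite ltnW // ltnW // ltn_expB.
- move=> _ /allP H _; rewrite expn1.
  by case: (ltnP x (size rho)) => lx; [apply/H/mem_nth | rewrite nth_default].
- move=> /andP[a2 we] hr se; apply: leq_trans (bs _ _ a2) _.
  by rewrite -{1}(expn1 B); apply: leq_expB.
- by move=> /andP[w1 w2] hr [s1 s2]; apply: op_le; auto.
- move=> /and3P[w0 w1 w2] hr [s0 s1 s2]; case: ifP => _.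
    by apply: leq_trans (IH2 _ _ _ _) (leq_expB _) => //; lia.
  by apply: leq_trans (IH1 _ _ _ _) (leq_expB _) => //; lia.
- move=> /andP[w0 w1] hr [s0 le s1].
  have H i : i < ev e0 rho s -> ev e1 (i :: rho) s <= B ^ height_term R e1.
    by move=> lti; apply: IH1; rewrite //= ?hr ?andbT; [lia | apply: s1].
  by apply: leq_trans (big_val_le b le H) (leq_expB _); lia.
Qed.

Definition reaches (p : prog) (s : state) (T : nat) (Q : state -> Prop) :=
  exists s' t, [/\ exec p s s' t, t <= T * unit_cost & Q s'].

Lemma reaches_mono p s T T' (Q Q' : state -> Prop) :
  reaches p s T Q -> T <= T' -> (forall s', Q s' -> Q' s') ->
  reaches p s T' Q'.
Proof.
move=> [s' [t [H le q]]] leT QQ; exists s', t; split=> //; last exact: QQ.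
by apply: leq_trans le _; rewrite leq_mul2r leT orbT.
Qed.

Lemma reaches_seq p1 p2 s T1 T2 Q :
  reaches p1 s T1 (fun s1 => reaches p2 s1 T2 Q) ->
  reaches (Seq p1 p2) s (T1 + T2) Q.
Proof.
case=> s1 [t1 [H1 le1 [s2 [t2 [H2 le2 q]]]]].
exists s2, (t1 + t2); split=> //; first exact: exec_seq H1 H2.
by rewrite mulnDl leq_add.
Qed.

Lemma bits_cell l : l <= h -> bits l <= bits V.
Proof. by move=> le; apply/leq_bits/(leq_trans le)/ltnW/ltn_expB. Qed.

Lemma reaches_set s a e1 e2 (Q : state -> Prop) :
  cost s e1 + cost s e2 + bits (eval s e1) + bits (eval s e2)
    <= 20 * bits V ->
  Q (update s a (eval s e1) (eval s e2)) -> reaches (Set_ a e1 e2) s 1 Q.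
Proof.
move=> le q; do 2! eexists; split; [exact: exec_set | | exact: q].
by rewrite mul1n.
Qed.

(* Iterations are counted down to follow the derivation of [While]. *)
Lemma reaches_while c body N T s (I : nat -> state -> Prop)
    (Q : state -> Prop) :
  (forall i s', i <= N -> I i s' ->
     eval s' c = N - i /\ cost s' c <= unit_cost) ->
  (forall i s', i < N -> I i s' -> reaches body s' T (I i.+1)) ->
  I 0 s -> (forall s', I N s' -> Q s') ->
  reaches (While c body) s (N * T.+1).+1 Q.
Proof.
move=> test step I0 IQ.
suff H n i s0 : n + i = N -> I i s0 ->
    reaches (While c body) s0 (n * T.+1).+1 Q.
  by apply: H I0; rewrite addn0.
elim: n i s0 => [|n IH] i s0 eN Ii.
  have [e0 le] := test i s0 ltac:(lia) Ii.
  exists s0, (cost s0 c); split; [apply: exec_while_false; lia | lia |].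
  by apply: IQ; rewrite -eN.
have [e0 le] := test i s0 ltac:(lia) Ii.
have [s1 [t1 [H1 l1 I1]]] := step i s0 ltac:(lia) Ii.
have [s2 [t2 [H2 l2 q2]]] := IH i.+1 s1 ltac:(lia) I1.
exists s2, (cost s0 c + t1 + t2); split=> //.
  by apply: exec_while_true H1 H2; rewrite e0; lia.
by nia.
Qed.

Definition env_ok (env : seq nat) l (rho : seq nat) (s : state) :=
  [/\ size env = size rho, all (leq^~ B) rho
    & forall x, x < size rho -> nth 0 env x < l /\
        s 2 (nth 0 env x) = nth 0 rho x].

Definition agree l (s s' : state) :=
  (forall a i, a != 2 -> s' a i = s a i) /\
  (forall i, i < l -> s' 2 i = s 2 i).

Lemma agree_refl l s : agree l s s. Proof. by []. Qed.

Lemma agree_trans l l' s1 s2 s3 :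
  agree l s1 s2 -> agree l' s2 s3 -> l <= l' -> agree l s1 s3.
Proof.
move=> [A1 A2] [B1 B2] le; split=> [a i a2|i li].
  by rewrite B1 // A1.
by rewrite B2 ?A2 //; lia.
Qed.

Lemma agree_leq l l' s1 s2 : agree l' s1 s2 -> l <= l' -> agree l s1 s2.
Proof. by move=> A le; apply: agree_trans (agree_refl _ _) A le. Qed.

Lemma agree_upd l c s x : l <= c -> agree l s (update s 2 c x).
Proof.
move=> le; split=> [a i a2|i li]; rewrite /update.
  by rewrite (negPf a2).
by rewrite (ltn_eqF (leq_trans li le)).
Qed.

Lemma env_ok_agree env l l' rho s s' :
  env_ok env l rho s -> agree l' s s' -> l <= l' -> env_ok env l' rho s'.
Proof.
move=> [sz le H] [_ A] ll; split=> // x lx; have [H1 H2] := H x lx.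
by split; [lia | rewrite A //; lia].
Qed.

Lemma env_ok_cons env l rho s i c :
  env_ok env l rho s -> s 2 c = i -> c < l -> i <= B ->
  env_ok (c :: env) l (i :: rho) s.
Proof.
move=> [sz le H] sc cl iB; split; rewrite /= ?sz ?iB //.
by case=> [|x] //= lx; apply: H.
Qed.

Lemma upd_same s a i x : update s a i x a i = x.
Proof. by rewrite /update !eqxx. Qed.

Lemma upd_other s i x j : j != i -> update s 2 i x 2 j = s 2 j.
Proof. by rewrite /update eqxx /= => /negPf->. Qed.

Lemma cost_tmp s l x : l <= h -> s 2 l = x -> x <= V ->
  cost s (tmp l) <= 3 * bits V.
Proof.
move=> lh <- xV; rewrite /=.
by have := bits_cell lh; have := leq_bits xV; lia.
Qed.

Lemma reaches_set_tmp s l e (Q : state -> Prop) :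
  l <= h -> cost s e <= 17 * bits V -> eval s e <= V ->
  Q (update s 2 l (eval s e)) -> reaches (set_tmp l e) s 1 Q.
Proof.
move=> lh c17 eV q; apply: reaches_set => //=.
by have := bits_cell lh; have := leq_bits eV; lia.
Qed.

Lemma cost_op s o l x y :
  l.+1 <= h -> s 2 l = x -> s 2 l.+1 = y -> x <= V -> y <= V ->
  cost s (op_expr o (tmp l) (tmp l.+1)) <= 8 * bits V /\
  eval s (op_expr o (tmp l) (tmp l.+1)) = op_fun o x y.
Proof.
move=> lh sx sy xV yV.
have c1 := cost_tmp (ltnW lh) sx xV; have c2 := cost_tmp lh sy yV.
have b1 := leq_bits xV; have b2 := leq_bits yV.
by case: o; split; rewrite /= ?sx ?sy //; move: c1 c2 b1 b2;
  rewrite /= ?sx ?sy; lia.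
Qed.

Lemma leV x m : x <= B ^ m -> m <= h -> x <= V.
Proof. by move=> lx le; apply: leq_trans lx (leq_expB _). Qed.

Lemma height_term_gt0 e : 0 < height_term R e.
Proof. by elim: e => //= e0 H0 e1 H1 e2 H2; lia. Qed.

Lemma reaches_counter l s N i (Q : state -> Prop) :
  l.+1 <= h -> s 2 l.+1 = i -> i < N -> N <= V ->
  Q (update s 2 l.+1 i.+1) ->
  reaches (set_tmp l.+1 (Add (tmp l.+1) (Const 1))) s 1 Q.
Proof.
move=> lh si iN NV q.
have c1 := cost_tmp lh si (leq_trans (ltnW iN) NV).
have b1 : bits 1 <= bits V by apply/leq_bits/expB_gt0.
have b2 := leq_bits (leq_trans (ltnW iN) NV).
apply: reaches_set_tmp => //=; rewrite si ?addn1 //; try lia.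
by move: c1 (bits_gt0 V); rewrite /= si; lia.
Qed.

(** [s] is the abstract state and [m] the machine state; they differ at most in array 2, which
    well-formed terms do not read. The bound [ev_le] and the room left below [h] keep all values and
    addresses within [V], so that each instruction costs at most one unit. *)
Lemma compile_termP e env l rho s m :
  wf_term e -> safe_term R e rho s -> bounded_state s ->
  (forall a i, a != 2 -> m a i = s a i) -> env_ok env l rho m ->
  l + height_term R e <= h ->
  reaches (compile_term env l e) m (steps_term R e)
    (fun m' => agree l m m' /\ m' 2 l = ev e rho s).
Proof.
move=> wfe sfe bs.
elim: e env l rho m wfe sfe => [x|x|a e IH|o e1 IH1 e2 IH2|e0 IH0 e1 IH1 e2 IH2
    |b e0 IH0 e1 IH1] env l rho m /=.
- move=> _ _ ms ok lh.
  have xV : x <= V by apply: leV (ltnW (ltn_expB _)) _; lia.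
  apply: reaches_set_tmp => //=; try lia.
    by have := leq_bits xV; lia.
  by split; [apply: agree_upd | rewrite upd_same].
- move=> _ _ ms ok lh; have [sz rB H] := ok.
  have h0 : 0 < h by lia.
  case: (ltnP x (size env)) => lx.
    have [H1 H2] := H x ltac:(by rewrite -sz).
    have xV : nth 0 rho x <= V.
      apply: leV (_ : _ <= B ^ 1) h0; rewrite expn1.
      by move/allP: rB; apply; rewrite mem_nth -?sz.
    apply: reaches_set_tmp; rewrite /= ?H2 //; try lia.
      have := cost_tmp (l := nth 0 env x) ltac:(lia) H2 xV.
      by rewrite /= H2; lia.
    by split; [apply: agree_upd | rewrite upd_same].
  apply: reaches_set_tmp => //=; try lia.
  by split; [apply: agree_upd | rewrite upd_same nth_default // -sz].
- move=> /andP[a2 we] se ms ok lh; rewrite -addn1; apply: reaches_seq.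
  have eB : ev e rho s <= V.
    by apply: leV (ev_le bs we _ se) _; [case: ok | lia].
  apply: reaches_mono (IH env l rho m we se ms ok _) _ _ => //; first lia.
  move=> m1 [ag m1l].
  have aB : m1 a (ev e rho s) <= V.
    rewrite (proj1 ag) // ms //; apply: leV (_ : _ <= B ^ 1) _; last lia.
    by rewrite expn1 bs.
  apply: reaches_set_tmp; rewrite /= ?m1l //; try lia.
    have := @bits_cell l ltac:(lia); have := leq_bits eB; have := leq_bits aB.
    by lia.
  split; first by apply: agree_trans ag (agree_upd _ _ _) (leqnn _).
  by rewrite upd_same (proj1 ag) // ms.
- move=> /andP[w1 w2] [s1 s2] ms ok lh; rewrite -[(_ + _).+1]addn1 -addnA.
  have rB : all (leq^~ B) rho by case: ok.
  have B1 := ev_le bs w1 rB s1; have B2 := ev_le bs w2 rB s2.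
  apply: reaches_seq.
  apply: reaches_mono (IH1 env l rho m w1 s1 ms ok _) _ _ => //; first lia.
  move=> m1 [ag1 m1l]; apply: reaches_seq.
  apply: reaches_mono (IH2 env l.+1 rho m1 w2 s2 _ _ _) _ _ => //; try lia.
    by move=> a i a2; rewrite (proj1 ag1) // ms.
    apply: env_ok_agree (_ : env_ok env l rho m1) (agree_refl l.+1 _) _ => //.
    exact: env_ok_agree ok ag1 _.
  move=> m2 [ag2 m2l].
  have m2l' : m2 2 l = ev e1 rho s by rewrite (proj2 ag2) // m1l.
  have [c8 ee] := cost_op o (l := l) ltac:(lia) m2l' m2l
    (leV B1 ltac:(lia)) (leV B2 ltac:(lia)).
  apply: reaches_set_tmp; rewrite ?ee; try lia.
    exact: leV (op_le o B1 B2) ltac:(lia).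
  split; last by rewrite upd_same.
  apply: agree_trans ag1 _ (leqnn _).
  by apply: agree_trans (agree_leq ag2 _) (agree_upd _ _ _) (leqnn _).
- move=> /and3P[w0 w1 w2] [s0 s1 s2] ms ok lh.
  have rB : all (leq^~ B) rho by case: ok.
  have B0 := ev_le bs w0 rB s0.
  have := height_term_gt0 e1; have := height_term_gt0 e2 => h2 h1.
  rewrite -addnA -addnS; apply: reaches_seq.
  apply: reaches_mono (IH0 env l rho m w0 s0 ms ok _) _ _ => //; first lia.
  move=> m1 [ag1 m1l].
  have ok1 : env_ok env l rho m1 by apply: env_ok_agree ok ag1 _.
  have ms1 a i : a != 2 -> m1 a i = s a i.
    by move=> a2; rewrite (proj1 ag1) // ms.
  have c3 := cost_tmp (l := l) ltac:(lia) m1l (leV B0 ltac:(lia)).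
  case: eqP => [e00|/eqP e00].
    have := IH2 env l rho m1 w2 s2 ms1 ok1 ltac:(lia).
    case=> m2 [t2 [H2 l2 [ag2 m2l]]]; exists m2, (cost m1 (tmp l) + t2); split.
    + by apply: exec_if_false H2; rewrite /= m1l.
    + by move: l2 c3; rewrite /unit_cost; lia.
    + by split=> //; apply: agree_trans ag1 ag2 (leqnn _).
  have := IH1 env l rho m1 w1 s1 ms1 ok1 ltac:(lia).
  case=> m2 [t2 [H2 l2 [ag2 m2l]]]; exists m2, (cost m1 (tmp l) + t2); split.
  + by apply: exec_if_true H2; rewrite /= m1l.
  + by move: l2 c3; rewrite /unit_cost; lia.
  + by split=> //; apply: agree_trans ag1 ag2 (leqnn _).
move=> /andP[w0 w1] [s0 le0 s1] ms ok lh.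
have rB : all (leq^~ B) rho by case: ok.
have B0 := ev_le bs w0 rB s0.
set N := ev e0 rho s in le0 s1 B0 *; set F := fun i => ev e1 (i :: rho) s.
have rBi i : i < N -> all (leq^~ B) (i :: rho).
  by move=> iN; rewrite /= rB andbT; lia.
have B1 i : i < N -> F i <= B ^ height_term R e1.
  by move=> iN; apply: ev_le (s1 _ iN) => //; apply: rBi.
have NV : N <= V by apply: leV B0 _; lia.
have BV i : i <= N -> big_val b i F <= V.
  move=> iN; apply: leV (big_val_le b (leq_trans iN le0) _) _.
    by move=> j ji; apply: B1; lia.
  by nia.
have h1 := height_term_gt0 e1.
apply: (reaches_mono (T := steps_term R e0 +
  (1 + (1 + ((N * (steps_term R e1 + (1 + 1)).+1).+1 + 1)))) _ _
  (fun _ H => H)); last nia.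
apply: reaches_seq.
apply: reaches_mono (IH0 env l rho m w0 s0 ms ok _) _ _ => //; first lia.
move=> m1 [ag1 m1l]; apply: reaches_seq.
apply: reaches_set_tmp => //=; first lia.
apply: reaches_seq.
apply: reaches_set_tmp => /=; first lia.
  have : bits b <= bits V by apply/leq_bits/(leq_trans (leq_b1 b))/expB_gt0.
  by lia.
  by apply/(leq_trans (leq_b1 b))/expB_gt0.
set m2 := update _ 2 l.+2 _.
have ag2 : agree l m m2.
  apply: agree_trans ag1 _ (leqnn _).
  by apply: agree_trans (agree_upd _ _ _) (agree_upd _ _ _) (leqnn _); lia.
pose I i m' := [/\ agree l m m', m' 2 l = N, m' 2 l.+1 = i
  & m' 2 l.+2 = big_val b i F].
apply: reaches_seq; apply: (reaches_while (I := I) (N := N)).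
- move=> i m' iN [ag ml ml1 _].
  have [] := cost_op Minus (l := l) ltac:(lia) ml ml1 NV (leq_trans iN NV).
  by move=> cc ee; split=> //; apply: leq_trans cc _; rewrite leq_mul2r orbT.
- move=> i m' iN [ag ml ml1 ml2]; apply: reaches_seq.
  apply: reaches_mono (IH1 (l.+1 :: env) l.+3 (i :: rho) m' w1 _ _ _ _) _ _.
  + exact: s1.
  + by move=> a j a2; rewrite (proj1 ag) // ms.
  + apply: env_ok_cons; rewrite ?ml1 //; last by lia.
    have ok' : env_ok env l rho m' by apply: env_ok_agree ok ag _.
    by apply: env_ok_agree ok' (agree_refl l.+3 _) _; lia.
  + by nia.
  + by [].
  move=> m3 [ag3 m3v]; apply: reaches_seq.
  have [c8 ee] := cost_op (if b then Times else Plus) (s := m3) (l := l.+2)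
    ltac:(nia) (etrans (proj2 ag3 l.+2 (ltnSn _)) ml2) m3v (BV _ (ltnW iN))
    (leV (B1 _ iN) ltac:(nia)).
  apply: reaches_set_tmp; rewrite ?ee -?big_valS; try lia.
    exact: BV.
  apply: (@reaches_counter l _ N i); try lia.
    by rewrite upd_other ?(proj2 ag3) ?ml1 //; lia.
  split.
  + apply: agree_trans ag _ (leqnn _).
    apply: agree_trans (agree_leq ag3 _) _ (leqnn _); first lia.
    by apply: agree_trans (agree_upd _ _ _) (agree_upd _ _ _) (leqnn _); lia.
  + by rewrite !upd_other ?(proj2 ag3) //; lia.
  + by rewrite upd_same.
  + by rewrite upd_other ?upd_same //; lia.
- rewrite /I; split=> //.
  + rewrite /m2 !upd_other //; lia.
  + rewrite /m2 upd_other ?upd_same //; lia.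
  + by rewrite /m2 upd_same big_val0.
- move=> m' [ag ml ml1 ml2].
  apply: reaches_set_tmp => //; first lia.
  + by have := cost_tmp (l := l.+2) ltac:(lia) ml2 (BV _ (leqnn _)); lia.
  + by rewrite /= ml2 BV.
  split; first by apply: agree_trans ag (agree_upd _ _ _) (leqnn _).
  by rewrite upd_same /= ml2.
Qed.

Lemma safe_bounded c rho s :
  wf c -> safe R W B c rho s -> bounded_state s -> bounded_state (run c rho s).
Proof.
elim: c rho s => [a e1 e2|c1 IH1 c2 IH2|b e c IH] rho s /=.
- move=> _ [_ _ le] bs a' i a2; rewrite /update.
  by case: ifP => // _; apply: bs.
- by move=> /andP[w1 w2] [s1 s2] bs; apply: IH2; auto.
- move=> /andP[we w1] [_ _ sf] bs.
  elim: {-2}(ev _ _ _) (leqnn (ev e rho s)) => //= i IHi lti.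
  by apply: IH => //; [apply: sf | apply: IHi; lia].
Qed.

Lemma compileP c env l rho s m :
  wf c -> safe R W B c rho s -> bounded_state s ->
  (forall a i, a != 2 -> m a i = s a i) -> env_ok env l rho m ->
  l + height R c <= h ->
  reaches (compile env l c) m (steps R W c)
    (fun m' => (forall a i, a != 2 -> m' a i = run c rho s a i) /\
               (forall i, i < l -> m' 2 i = m 2 i)).
Proof.
elim: c env l rho s m => [a e1 e2|c1 IH1 c2 IH2|b e c IH] env l rho s m /=.
- move=> /and3P[a2 w1 w2] [s1 s2 le] bs ms ok lh.
  have rB : all (leq^~ B) rho by case: ok.
  have B1 := ev_le bs w1 rB s1; have B2 := ev_le bs w2 rB s2.
  apply: (reaches_mono (T := steps_term R e1 + (steps_term R e2 + 1)) _ _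
    (fun _ H => H)); last lia.
  apply: reaches_seq.
  apply: reaches_mono (compile_termP w1 s1 bs ms ok _) _ _ => //; first lia.
  move=> m1 [ag1 m1l]; apply: reaches_seq.
  apply: reaches_mono (compile_termP (l := l.+1) w2 s2 bs _ _ _) _ _ => //;
    try lia.
    by move=> a' i a2'; rewrite (proj1 ag1) // ms.
    apply: env_ok_agree (_ : env_ok env l rho m1) (agree_refl l.+1 _) _ => //.
    exact: env_ok_agree ok ag1 _.
  move=> m2 [ag2 m2l].
  have m2l' : m2 2 l = ev e1 rho s by rewrite (proj2 ag2) // m1l.
  have c1 := cost_tmp (l := l) ltac:(lia) m2l' (leV B1 ltac:(lia)).
  have c2 := cost_tmp (l := l.+1) ltac:(lia) m2l (leV B2 ltac:(lia)).
  apply: reaches_set.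
    have := leq_bits (leV B1 ltac:(lia)); have := leq_bits (leV B2 ltac:(lia)).
    by move: c1 c2; rewrite /= m2l m2l'; lia.
  rewrite /= m2l m2l'; split=> [a' i a2'|i li]; rewrite /update.
    by case: ifP => // _; rewrite (proj1 ag2) // (proj1 ag1) // ms.
  rewrite eq_sym (negPf a2) /= (proj2 ag2) ?(proj2 ag1) //; lia.
- move=> /andP[w1 w2] [s1 s2] bs ms ok lh; apply: reaches_seq.
  apply: reaches_mono (IH1 env l rho s m w1 s1 bs ms ok _) _ _ => //; first lia.
  move=> m1 [ms1 lo1].
  apply: reaches_mono (IH2 env l rho _ m1 w2 s2 _ ms1 _ _) _ _ => //.
  + exact: safe_bounded.
  + case: ok => sz rB H; split=> // x lx; have [xl <-] := H x lx.
    by rewrite lo1.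
  + by lia.
  by move=> m2 [ms2 lo2]; split=> // i li; rewrite lo2 ?lo1.
- move=> /andP[we w1] [s0 le0 s1] bs ms ok lh.
  have rB : all (leq^~ B) rho by case: ok.
  have B0 := ev_le bs we rB s0.
  set N := ev e rho s in le0 s1 B0 *.
  have NV : N <= V by apply: leV B0 _; lia.
  have NB : N <= B by case: b le0 => le0; apply: leq_trans le0 _.
  pose f := fun j => run c (j :: rho).
  have bsi i : i <= N -> bounded_state (iteri i f s).
    elim: i => //= i IHi lti; apply: safe_bounded => //;
      last by apply: IHi; lia.
    exact: s1.
  apply: (reaches_mono (T := steps_term R e + (1 +
    (N * (steps R W c + 1).+1).+1)) _ _ (fun _ H => H)); last first.
    by move: le0; case: (b) => le0; nia.
  apply: reaches_seq.
  apply: reaches_mono (compile_termP we s0 bs ms ok _) _ _ => //; first lia.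
  move=> m1 [ag1 m1l]; apply: reaches_seq.
  apply: reaches_set_tmp => //=; first lia.
  pose I i m' := [/\ forall a j, a != 2 -> m' a j = iteri i f s a j,
    forall j, j < l -> m' 2 j = m 2 j, m' 2 l = N & m' 2 l.+1 = i].
  apply: (reaches_while (I := I) (N := N)).
  + move=> i m' iN [_ _ ml ml1].
    have [] := cost_op Minus (l := l) ltac:(lia) ml ml1 NV (leq_trans iN NV).
    move=> cc ee; split=> //; apply: leq_trans cc _.
    by rewrite leq_mul2r orbT.
  + move=> i m' iN [ms' lo ml ml1]; apply: reaches_seq.
    apply: reaches_mono (IH (l.+1 :: env) l.+2 (i :: rho) _ m' w1 (s1 _ iN)
      (bsi _ (ltnW iN)) ms' _ _) _ _ => //.
    * apply: env_ok_cons; rewrite ?ml1 //; last by lia.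
      case: ok => sz _ H; split=> // x lx; have [xl <-] := H x lx.
      by split; [lia | rewrite lo].
    * by lia.
    move=> m3 [ms3 lo3]; apply: (@reaches_counter l _ N i); try lia.
      by rewrite lo3 ?ml1.
    split.
    * by move=> a j a2; rewrite /update (negPf a2) /= ms3.
    * by move=> j jl; rewrite upd_other ?lo3 ?lo //; lia.
    * by rewrite upd_other ?lo3 ?ml //; lia.
    * by rewrite upd_same.
  + split=> //.
    * move=> a j a2; rewrite /update (negPf a2) /= (proj1 ag1) // ms //.
    * by move=> j jl; rewrite upd_other ?(proj2 ag1) //; lia.
    * by rewrite upd_other ?m1l //; lia.
    * by rewrite upd_same.
  + by move=> m' [? ? _ _].
Qed.

End Correctness.

(** [h] need only dominate a number computed from the program text and [R]. If [B] is a power of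
    [n + 2], the bit length of [B ^ h] is then logarithmic in [n], up to a factor depending on [d]
    and [k]. *)
Theorem compile_correct R W B h c s :
  1 < B -> R <= B -> W <= B -> height R c <= h -> wf c ->
  bounded_state B s -> safe R W B c [::] s ->
  exists s' t,
    [/\ exec (compile [::] 0 c) s s' t,
        t <= steps R W c * (20 * bits (B ^ h))
      & forall a i, a != 2 -> s' a i = run c [::] s a i].
Proof.
move=> B2 RB WB hh wc bs sf.
have [] // := @compileP R W B h B2 RB WB c [::] 0 [::] s s.
by move=> s' [t [H le [Q _]]]; exists s', t.
Qed.

(** * Elementary bounds *)

(* All factors depending only on [d] and [k] are absorbed by a tower, so they
   never need to be computed. *)
Definition tower (n : nat) : nat := iter n (expn 2) 1.

Lemma tower_gt0 n : 0 < tower n.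
Proof. by case: n => //= n; rewrite expn_gt0. Qed.

Lemma leq_tower m n : m <= n -> tower m <= tower n.
Proof.
elim: n => [|n IH]; first by rewrite leqn0 => /eqP->.
rewrite leq_eqVlt => /predU1P[->//|/IH le].
by apply: leq_trans le _; rewrite /= ltnW // ltn_expl.
Qed.

Lemma ltn_tower n : n < tower n.
Proof.
elim: n => //= n IH.
by apply: leq_ltn_trans IH _; rewrite ltn_expl.
Qed.

Definition elementary (F : nat -> nat -> nat) : Prop :=
  exists c, forall d k, F d k <= tower (c + d + k).

Lemma elementary_le F G :
  (forall d k, F d k <= G d k) -> elementary G -> elementary F.
Proof.
by move=> le [c H]; exists c => d k; apply: leq_trans (le d k) (H d k).
Qed.

Lemma elementary_const m : elementary (fun _ _ => m).
Proof.
exists m => d k; apply: leq_trans (ltnW (ltn_tower m)) (leq_tower _); lia.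
Qed.

Lemma elementary_fst : elementary (fun d _ => d).
Proof.
exists 0 => d k; apply: leq_trans (ltnW (ltn_tower d)) (leq_tower _); lia.
Qed.

Lemma elementary_snd : elementary (fun _ k => k).
Proof.
exists 0 => d k; apply: leq_trans (ltnW (ltn_tower k)) (leq_tower _); lia.
Qed.

Lemma double_leq_expn t : t.*2 <= 2 ^ t.
Proof.
by elim: t => // -[|t] IH //; rewrite expnS mul2n leq_double ltn_expl.
Qed.

Lemma sqr_leq_expn t : t * t <= 2 ^ (2 ^ t).
Proof.
apply: leq_trans (_ : 2 ^ t.*2 <= _); last first.
  by rewrite leq_exp2l // double_leq_expn.
by rewrite -addnn expnD leq_mul // ltnW // ltn_expl.
Qed.

Lemma elementary2 F G : elementary F -> elementary G ->
  exists c, forall d k,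
    F d k <= tower (c + d + k) /\ G d k <= tower (c + d + k).
Proof.
move=> [c1 H1] [c2 H2]; exists (c1 + c2) => d k; split.
  by apply: leq_trans (H1 d k) (leq_tower _); lia.
by apply: leq_trans (H2 d k) (leq_tower _); lia.
Qed.

Lemma elementary_add F G :
  elementary F -> elementary G -> elementary (fun d k => F d k + G d k).
Proof.
move=> eF eG; have [c H] := elementary2 eF eG; exists c.+1 => d k.
have [lF lG] := H d k; rewrite !addSn /=.
apply: leq_trans (double_leq_expn _); rewrite -addnn; exact: leq_add.
Qed.

Lemma elementary_mul F G :
  elementary F -> elementary G -> elementary (fun d k => F d k * G d k).
Proof.
move=> eF eG; have [c H] := elementary2 eF eG; exists c.+2 => d k.
have [lF lG] := H d k; rewrite !addSn /=.
apply: leq_trans (sqr_leq_expn _); exact: leq_mul.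
Qed.

(** With [t] a bound on both, [t ^ t <= 2 ^ (t * t)] and [t * t <= 2 ^ (2 ^ t)], which makes three
    more levels. *)
Lemma elementary_exp F G :
  elementary F -> elementary G -> elementary (fun d k => F d k ^ G d k).
Proof.
move=> eF eG; have [c H] := elementary2 eF eG; exists c.+3 => d k.
have [lF lG] := H d k; rewrite !addSn /=; set t := tower _ in lF lG *.
apply: leq_trans (_ : 2 ^ (t * G d k) <= _).
  rewrite expnM; case: (posnP (G d k)) => [->|G0] //.
  by rewrite leq_exp2r // (leq_trans lF) // ltnW // ltn_expl.
rewrite leq_exp2l //; apply: leq_trans (sqr_leq_expn _).
by rewrite leq_mul2l lG orbT.
Qed.

Lemma elementary_succ F : elementary F -> elementary (fun d k => (F d k).+1).
Proof.
move=> eF; apply: elementary_le (elementary_add eF (elementary_const 1)) => d k.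
by rewrite addn1.
Qed.

Ltac elem := repeat lazymatch goal with
  | H : elementary ?F |- elementary ?F => exact H
  | H : elementary ?F |- elementary (fun d k => ?F d k) => exact H
  | |- elementary (fun _ _ => ?m) => exact: elementary_const
  | |- elementary (fun d _ => d) => exact: elementary_fst
  | |- elementary (fun _ k => k) => exact: elementary_snd
  | |- elementary (fun d k => addn (@?F d k) (@?G d k)) =>
      apply: (@elementary_add F G)
  | |- elementary (fun d k => muln (@?F d k) (@?G d k)) =>
      apply: (@elementary_mul F G)
  | |- elementary (fun d k => expn (@?F d k) (@?G d k)) =>
      apply: (@elementary_exp F G)
  | |- elementary (fun d k => S (@?F d k)) => apply: (@elementary_succ F)
  end.

Lemma elementary_height_term R e :
  elementary R -> elementary (fun d k => height_term (R d k) e).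
Proof. by move=> eR; elim: e => *; rewrite /=; elem. Qed.

Lemma elementary_height R c :
  elementary R -> elementary (fun d k => height (R d k) c).
Proof.
move=> eR; elim: c => *; rewrite /=; elem; exact: elementary_height_term.
Qed.

Lemma elementary_steps_term R e :
  elementary R -> elementary (fun d k => steps_term (R d k) e).
Proof. by move=> eR; elim: e => *; rewrite /=; elem. Qed.

Lemma elementary_steps R c :
  elementary R -> elementary (fun d k => steps (R d k) 1 c).
Proof.
move=> eR; elim: c => [a e1 e2|c1 IH1 c2 IH2|[] e c IH]; rewrite /=; elem;
  exact: elementary_steps_term.
Qed.

(** * Loops depending on [n] are never nested *)

Fixpoint no_big (c : stmt) : bool :=
  match c with
  | Asg _ _ _ => true
  | Sq c1 c2 => no_big c1 && no_big c2
  | For b _ c1 => ~~ b && no_big c1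
  end.

Fixpoint unnested (c : stmt) : bool :=
  match c with
  | Asg _ _ _ => true
  | Sq c1 c2 => unnested c1 && unnested c2
  | For b _ c1 => if b then no_big c1 else unnested c1
  end.

Lemma steps_no_big R W c : no_big c -> steps R W c = steps R 1 c.
Proof.
elim: c => //= [c1 IH1 c2 IH2 /andP[/IH1-> /IH2->] //|[] e c IH //= /IH->//].
Qed.

(** The body of a long loop contains no other long loop, so its own step count is free of [W]: the
    factor [W] occurs once and not to a power. *)
Lemma steps_unnested R W c :
  0 < W -> unnested c -> steps R W c <= steps R 1 c * W.
Proof.
move=> W0; elim: c => [a e1 e2|c1 IH1 c2 IH2|[] e c IH] /=.
- by move=> _; rewrite leq_pmulr.
- by move=> /andP[/IH1 ? /IH2 ?]; rewrite mulnDl leq_add.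
- by move=> nb; rewrite (steps_no_big _ _ nb); nia.
- by move=> /IH; nia.
Qed.

(** * Towers are computable *)

Definition tower_code (C : nat) : stmt :=
  Sq (Asg 1 (Cst 0) (Cst 1))
     (For false (Op Plus (Op Plus (Cst C) (Cell 0 (Cst 0))) (Cell 0 (Cst 1)))
       (Asg 1 (Cst 0) (Big true (Cell 1 (Cst 0)) (Cst 2)))).

Lemma computable_tower C : computable2 (fun d k => tower (C + d + k)).
Proof.
exists (compile [::] 0 (tower_code C)) => x y.
(* [R] will bound all lengths and stored values; only halting matters here. The added levels give
   [1 < R] even for [N = 0]. *)
set N := C + x + y; pose R := (tower N.+2).
pose s := init [:: x; y].
have NR : N < R by apply: leq_trans (ltn_tower N) (leq_tower _); lia.
pose I i (s' : state) := s' 1 0 = tower i /\ s' 0 = s 0.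
have : wp R R R (tower_code C) [::] s (fun s' => s' 1 0 = tower N).
  apply: wp_seq; apply: wp_asg => //=; first exact: tower_gt0.
  apply: (wp_for (I := I)) => //=; first exact: ltnW.
  - move=> i s' iN [s'1 s'0]; have {}iN : i < N by exact: iN.
    have tR : tower i.+1 <= R by apply: leq_tower; lia.
    apply: wp_asg => //=.
    + by split=> //; rewrite s'1; apply: leq_tower; lia.
    + by rewrite /big_val prod_nat_const_nat subn0 s'1.
    + by rewrite /I /update /= /big_val prod_nat_const_nat subn0 s'1.
  - by move=> s' [].
case=> sf q.
have [] := @compile_correct R R R (height R (tower_code C)) (tower_code C) s
  => //.
- by apply: leq_trans (leq_tower (_ : 1 <= _)).
- move=> a i _; rewrite /s /init; case: (a == 0) => //.
  have [xR yR] : x <= R /\ y <= R by split; move: NR; rewrite /N; lia.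
  by case: i => [|[|i]] //=; rewrite nth_nil.
move=> s' [t [H _ E]]; exists t; exists s' => //.
by rewrite E.
Qed.

(** * Dynamic programming over a certificate *)

Section Counting.

Variables (k n : nat) (P : rel 'I_k) (E : rel 'I_n.+1).

Definition closed_set (A : {set 'I_k}) : Prop :=
  forall u v, u \in A -> P u v -> v \in A.

(* Partial maps: the value 0 means undefined. *)
Notation pmap := {ffun 'I_k -> 'I_n.+1}.

Implicit Types (A : {set 'I_k}) (f g : pmap).

Definition restr (A : {set 'I_k}) (f : pmap) : pmap :=
  [ffun v => if v \in A then f v else ord0].

(** Only the tail of an arc is required to lie in [A]. For closed [A] the head lies there too, and
    these are the homomorphisms from the part of [P] induced by [A], extended by 0. *)
Definition homs (A : {set 'I_k}) : {set pmap} :=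
  [set f : pmap | [forall v, (f v != ord0) == (v \in A)] &&
           [forall u, forall v, (u \in A) && P u v ==> E (f u) (f v)]].

Lemma homsP A f :
  reflect ((forall v, (f v != ord0) = (v \in A)) /\
           (forall u v, u \in A -> P u v -> E (f u) (f v)))
          (f \in homs A).
Proof.
rewrite inE; apply: (iffP andP) => [[/forallP H1 /forallP H2]|[H1 H2]]; split.
- by move=> v; exact: (eqP (H1 v)).
- by move=> u v uA uv; have /forallP/(_ v) := H2 u; rewrite uA uv.
- by apply/forallP => v; rewrite H1.
- by apply/forallP => u; apply/forallP => v; apply/implyP => /andP[]; apply: H2.
Qed.

Lemma homs_out A f v : f \in homs A -> v \notin A -> f v = ord0.
Proof. by move=> /homsP[H _] vA; apply/eqP; rewrite -[_ == _]negbK H. Qed.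

Lemma restr_restr A A' f : A \subset A' -> restr A (restr A' f) = restr A f.
Proof.
move=> /subsetP sub; apply/ffunP => v; rewrite !ffunE.
by case: ifP => // vA; rewrite sub.
Qed.

Lemma homs_restr A A' f :
  closed_set A -> A \subset A' -> f \in homs A' -> restr A f \in homs A.
Proof.
move=> cA /subsetP sub /homsP[H1 H2]; apply/homsP; split=> [v|u v uA uv].
  by rewrite ffunE; case: ifP => [/sub vA|//]; rewrite H1 vA.
by rewrite !ffunE uA (cA _ _ uA uv) H2 // sub.
Qed.

Definition merge (A : {set 'I_k}) (f g : pmap) : pmap :=
  [ffun v => if v \in A then f v else g v].

(** Two partial homomorphisms that agree on the intersection glue to one on the union: an arc
    leaving a node of a closed set stays in that set, so no arc joins the two differences.
    Restriction to both sets and [merge] are inverse to each other. *)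
Lemma sum_merge A A' (F G : pmap -> nat) :
  closed_set A -> closed_set A' ->
  \sum_(f in homs (A :|: A')) F (restr A f) * G (restr A' f) =
  \sum_(f in homs A) F f *
    \sum_(g in homs A' | restr (A' :&: A) g == restr (A' :&: A) f) G g.
Proof.
move=> cA cA'.
under [RHS]eq_bigr do rewrite big_distrr /=.
rewrite pair_big_dep /=.
rewrite (reindex_onto (fun f => (restr A f, restr A' f))
  (fun fg => merge A fg.1 fg.2)) /=.
  apply: eq_bigl => f; apply/idP/idP => [fH|].
    rewrite !(homs_restr _ _ fH) ?subsetUl ?subsetUr //=.
    rewrite !restr_restr ?subsetIl ?subsetIr // eqxx /=.
    apply/eqP/ffunP => v; rewrite !ffunE.
    case: (boolP (v \in A)) => // vA; case: (boolP (v \in A')) => // vA'.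
    by rewrite (homs_out fH) // inE (negPf vA) (negPf vA').
  case/andP=> /and3P[/homsP[HA HA2] /homsP[HB HB2] _] /eqP fE.
  have off v : v \notin A -> v \notin A' -> f v = ord0.
    by move=> vA vA'; rewrite -fE !ffunE (negPf vA) (negPf vA').
  apply/homsP; split=> [v|u v].
    rewrite inE; case: (boolP (v \in A)) => vA.
      by have := HA v; rewrite ffunE vA.
    case: (boolP (v \in A')) => vA'; first by have := HB v; rewrite ffunE vA'.
    by rewrite off.
  rewrite inE => /orP[] uA uv.
    by have := HA2 _ _ uA uv; rewrite !ffunE uA (cA _ _ uA uv).
  by have := HB2 _ _ uA uv; rewrite !ffunE uA (cA' _ _ uA uv).
case=> f g /= /and3P[fH gH /eqP fg]; congr (_, _).
  apply/ffunP => v; rewrite !ffunE; case: (boolP (v \in A)) => // vA.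
  by rewrite (homs_out fH).
apply/ffunP => v; rewrite !ffunE; case: ifP => [vA'|vA'].
  case: ifP => // vA; have := congr1 (fun h : pmap => h v) fg.
  by rewrite !ffunE inE vA vA'.
by rewrite (homs_out gH) // vA'.
Qed.

Variables (m : nat) (S : nat -> {set 'I_k}) (p : nat -> nat).
Hypothesis S_closed : forall i, i < m -> closed_set (S i).
Hypothesis p_lt : forall i, 0 < i < m -> p i < i.
Hypothesis S_inter : forall i j v,
  j < i < m -> v \in S i -> v \in S j -> v \in S (p i).

Definition below (t : nat) : {set 'I_k} := \bigcup_(i < t) S i.

Lemma in_below t v : reflect (exists2 i, i < t & v \in S i) (v \in below t).
Proof.
apply: (iffP bigcupP) => [[i _ vi]|[i it vi]]; first by exists i.
by exists (Ordinal it).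
Qed.

Lemma below_closed t : t <= m -> closed_set (below t).
Proof.
move=> tm u v /in_below[i it ui] uv; apply/in_below; exists i => //.
by apply: S_closed ui uv; apply: leq_trans it tm.
Qed.

Variable D : nat -> pmap -> nat.

(** The product runs over the children of [t], each table being read at the restriction to what the
    child shares with [t]. [D] stands for the table of partial sums, and [D_eq] is its recursion. *)
Definition weight (t : nat) (f : pmap) : nat :=
  \prod_(j < m | (t < j) && (p j == t)) D j (restr (S j :&: S (p j)) f).

Hypothesis D_eq : forall t f, t < m ->
  D t f = \sum_(g in homs (S t) | restr (S t :&: S (p t)) g == f) weight t g.

Lemma inter_below t :
  0 < t < m -> S t :&: below t = S t :&: S (p t).
Proof.
move=> /andP[t0 tm]; apply/setP => v; rewrite !inE.
case: (boolP (v \in S t)) => //= vt; apply/in_below/idP.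
  by case=> j jt vj; apply: (@S_inter t j v); rewrite ?jt.
by move=> vp; exists (p t) => //; apply: p_lt; rewrite t0.
Qed.

(* Peels off the last set: by [inter_below] it meets the union of the earlier
   ones inside its parent. *)
Lemma card_homs_below r t : t + r = m -> 0 < t ->
  #|homs (below m)| = \sum_(f in homs (below t))
    \prod_(j < m | (t <= j) && (p j < t)) D j (restr (S j :&: S (p j)) f).
Proof.
elim: r t => [|r IH] t tr t0.
  have -> : t = m by lia.
  rewrite -sum1_card; apply: eq_bigr => f _; rewrite big1 // => j.
  by rewrite leqNgt ltn_ord.
have tm : t < m by lia.
rewrite (IH t.+1) //; last lia.
have -> : below t.+1 = below t :|: S t by rewrite /below big_ord_recr.
(* Factors whose parent is [t] see [f] only inside [S t] and make up [weight t]; the others have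
   parents before [t] and see [f] only inside [below t]. *)
transitivity (\sum_(f in homs (below t :|: S t))
  (\prod_(j < m | (t < j) && (p j < t))
      D j (restr (S j :&: S (p j)) (restr (below t) f))) *
  weight t (restr (S t) f)).
  apply: eq_bigr => f _; rewrite (bigID (fun j : 'I_m => p j == t)) /= mulnC.
  congr (_ * _).
    apply: eq_big => [j|j /andP[/andP[tj pt] pj]]; first by lia.
    rewrite restr_restr //; apply/subsetP => v; rewrite inE => /andP[_ vp].
    by apply/in_below; exists (p j) => //; lia.
  apply: eq_big => [j|j /andP[_ /eqP pj]]; first by lia.
  by rewrite restr_restr // pj subsetIr.
rewrite (sum_merge (fun f => \prod_(j < m | (t < j) && (p j < t))
  D j (restr (S j :&: S (p j)) f)) (weight t) (below_closed (ltnW tm))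
  (S_closed tm)).
(* The inner sum is the table entry of [t], which is the factor [j = t] of the product on the
   right. *)
apply: eq_bigr => f _; rewrite inter_below ?t0 // -D_eq //.
rewrite [RHS](bigD1 (Ordinal tm)) /= ?leqnn ?p_lt ?t0 // mulnC.
by congr (_ * _); apply: eq_bigl => j; rewrite -val_eqE /=; lia.
Qed.

(** At index 1 the formula ranges over partial maps on the empty root set. The empty map is the only
    one, and what remains is the recursion for [D 0]. *)
Lemma card_homs_root : 0 < m -> S 0 = set0 ->
  #|homs (below m)| = D 0 [ffun=> ord0].
Proof.
move=> m0 S0; rewrite (@card_homs_below m.-1 1) //; last by lia.
have b1 : below 1 = set0 by rewrite /below big_ord1.
have e0 f : restr set0 f = [ffun=> ord0].
  by apply/ffunP => v; rewrite !ffunE inE.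
have H0 f : f \in homs set0 -> f = [ffun=> ord0].
  by move=> fH; apply/ffunP => v; rewrite ffunE (homs_out fH) // inE.
have H1 : [ffun=> ord0] \in homs set0.
  by apply/homsP; split=> [v|u v]; rewrite !inE // ffunE eqxx.
rewrite b1 (big_pred1 [ffun=> ord0]) => [|f]; last first.
  by apply/idP/eqP => [/H0|->].
rewrite D_eq // S0 set0I (big_pred1 [ffun=> ord0]) => [|f]; last first.
  by rewrite e0; apply/andP/eqP => [[/H0]|->].
by apply: eq_bigl => j; rewrite ltnS leqn0.
Qed.

End Counting.

(** Vertices of [G] are shifted by one to make room for the value 0, which total maps never take. *)
Lemma card_homs_setT (k n : nat) (P : rel 'I_k) (G : rel 'I_n)
    (E : rel 'I_n.+1) :
  (forall x y, E (lift ord0 x) (lift ord0 y) = G x y) ->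
  #|homs P E setT| = hom P G.
Proof.
move=> EG.
pose up (phi : {ffun 'I_k -> 'I_n}) : {ffun 'I_k -> 'I_n.+1} :=
  [ffun v => lift ord0 (phi v)].
have up_inj : injective up.
  move=> f g fg; apply/ffunP => v; apply: (@lift_inj _ ord0).
  by move/(congr1 (fun h : {ffun _} => h v)): fg; rewrite !ffunE.
rewrite /hom -(card_imset _ up_inj); apply: eq_card => f.
apply/idP/imsetP => [/homsP[H1 H2]|[phi]].
  have fx v : exists x, f v == lift ord0 x.
    case: (unliftP ord0 (f v)) => [x ->|f0]; first by exists x.
    by have := H1 v; rewrite f0 eqxx inE.
  have fphi v : lift ord0 (xchoose (fx v)) = f v.
    exact/esym/eqP/(xchooseP (fx v)).
  exists [ffun v => xchoose (fx v)]; last first.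
    by apply/ffunP => v; rewrite !ffunE fphi.
  rewrite inE; apply/forallP => u; apply/forallP => v; apply/implyP => uv.
  by rewrite !ffunE -EG !fphi H2 ?inE.
rewrite inE => /forallP H ->; apply/homsP; split=> [v|u v _ uv].
  by rewrite ffunE inE.
by rewrite !ffunE EG; have /forallP/(_ v)/implyP := H u; apply.
Qed.

(** * Certificates *)

(* [q i v = 0] means that [v] is outside the [i]-th set, [q i v = v.+1] that
   its image is guessed freely, and [q i v = u.+1] that its image is guessed
   among the out-neighbours of the image of [u]; [q i k] is the parent of
   [i].  Set 0 is an empty root. *)
Section Certificates.

Variables (k : nat) (P : rel 'I_k).

Definition cert_set (q : nat -> nat -> nat) (i : nat) : {set 'I_k} :=
  [set v : 'I_k | q i v != 0].

Definition cert_source (q : nat -> nat -> nat) (i : nat) (v : 'I_k) : Prop :=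
  q i v != v.+1 ->
  exists u : 'I_k, [/\ q i v = u.+1, P u v & u \in cert_set q i].

Record certificate (m w : nat) (q : nat -> nat -> nat) : Prop := Certificate {
  cert_guess : forall i v, i < m -> v \in cert_set q i -> cert_source q i v;
  cert_closed : forall i u v, i < m ->
    u \in cert_set q i -> P u v -> v \in cert_set q i;
  cert_parent : forall i, 0 < i < m -> q i k < i;
  cert_inter : forall i j v, j < i < m ->
    v \in cert_set q i -> v \in cert_set q j -> v \in cert_set q (q i k);
  cert_root : cert_set q 0 = set0;
  cert_cover : forall v, exists2 i, i < m & v \in cert_set q i;
  cert_width : forall i, i < m -> #|[set v : 'I_k | q i v == v.+1]| <= w
}.

(** * From a decomposition to a certificate *)

Hypothesis acP : acyclic P.

(** The number of ancestors. It grows strictly along the arcs of a dag, which gives minimal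
    ancestors and an order in which derived images can be computed. *)
Definition rank (v : 'I_k) : nat := #|[set u | connect P u v]|.

Lemma rank_le v : rank v <= k.
Proof. by rewrite -[X in _ <= X]card_ord max_card. Qed.

Lemma rank_lt u v : P u v -> rank u < rank v.
Proof.
move=> uv; apply: proper_card; apply/properP; split.
  apply/subsetP => x; rewrite !inE => xu.
  exact: connect_trans xu (connect1 uv).
exists v; rewrite !inE ?connect0 //; apply/negP => /connectP[c vc lc].
suff : v :: c = [::] by [].
by apply: acP; rewrite /= rcons_path vc -lc.
Qed.

Lemma reach_pred (A : {set 'I_k}) v :
  v \in reach_set P A -> v \notin A ->
  exists u, (u \in reach_set P A) && P u v.
Proof.
move=> /bigcupP[s sA]; rewrite inE => /connectP[c].
case/lastP: c => [|c x]; first by move=> _ /= ->; rewrite sA.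
rewrite rcons_path last_rcons => /andP[sc cx] -> _.
exists (last s c); rewrite cx andbT; apply/bigcupP; exists s => //.
by rewrite inE; apply/connectP; exists c.
Qed.

(** An ancestor of least rank has no predecessor. *)
Lemma source_above v : exists2 s, s \in sources P & connect P s v.
Proof.
case: (arg_minnP rank (P := fun u => connect P u v) (connect0 P v)).
move=> s sv mins.
exists s => //; rewrite inE; apply/forallP => u; apply/negP => us.
by have := mins u (connect_trans (connect1 us) sv); rewrite leqNgt rank_lt.
Qed.

Lemma exit_arc (T : eqType) (a : rel T) (L : seq T) x c :
  path a x c -> x \in L -> last x c \notin L ->
  exists u v, [/\ u \in L, v \notin L & a u v].
Proof.
elim: c x => [|y c IH] x /= => [_ ->//|/andP[xy yc] xL lc].
by case: (boolP (y \in L)) => yL; [apply: IH yc yL lc | exists x, y].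
Qed.

(* Grows a connected set of nodes from the root, so that each new node [x] is
   attached to an old node [y]: paths from [x] to the other old nodes then
   start through [y]. *)
Lemma tree_order (T : finType) (N : {set T}) (a : rel T) (r : T) :
  is_tree N a -> r \in N ->
  exists (L : seq T) (par : nat -> nat),
    [/\ uniq L, L =i N & forall i j, j < i < size L ->
        par i < i /\
        on_tree_path a (nth r L i) (nth r L j) (nth r L (par i))].
Proof.
case=> syma _ aN conN _ rN.
(* The induction also carries connectedness inside [L]: it provides a path from the attachment point
   to any old node that avoids the new node. *)
suff H t : t < #|N| -> exists (L : seq T) (par : nat -> nat),
  [/\ uniq L, {subset L <= N}, size L = t.+1,
      {in L &, forall x y, exists c,
         [/\ path a x c, last x c = y & {subset c <= L}]}
    & forall i j, j < i < size L -> par i < i /\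
        on_tree_path a (nth r L i) (nth r L j) (nth r L (par i))].
  have N0 : 0 < #|N| by apply/card_gt0P; exists r.
  have [|L [par [uL LN sL _ HL]]] := H #|N|.-1; first by rewrite prednK.
  exists L, par; split=> //.
  rewrite prednK // in sL.
  have /subset_cardP H1 : #|L| = #|N| by rewrite (card_uniqP uL).
  by apply: H1; apply/subsetP.
elim: t => [|t IH] tN.
  exists [:: r], id; split=> //.
  - by move=> x; rewrite inE => /eqP->.
  - by move=> x y; rewrite !inE => /eqP-> /eqP->; exists [::].
  - by move=> i j /=; lia.
have [L [par [uL LN sL cL HL]]] := IH (ltnW tN).
have [z zN zL] : exists2 z, z \in N & z \notin L.
  apply/subsetPn; apply/negP => /subset_leq_card.
  by rewrite (card_uniqP uL) sL leqNgt tN.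
have [x xL] : exists x, x \in L.
  by case: (L) sL => // x s _; exists x; rewrite inE eqxx.
have /connectP[c xc lc] := conN _ _ (LN _ xL) zN.
have [] := exit_arc (L := L) xc xL; first by rewrite -lc.
move=> u [v [uL' vL uv]].
have vN : v \in N by case/andP: (aN _ _ uv).
exists (rcons L v), (fun i => if i == size L then index u L else par i).
split.
- by rewrite rcons_uniq vL.
- by move=> y; rewrite mem_rcons inE => /predU1P[->//|/LN].
- by rewrite size_rcons sL.
- have sub e : {subset e <= L} -> {subset e <= rcons L v}.
    by move=> eL y /eL yL; rewrite mem_rcons inE yL orbT.
  move=> y1 y2; rewrite !mem_rcons !inE.
  move=> /predU1P[->|y1L] /predU1P[->|y2L].
  + by exists [::].
  + have [e [ue le eL]] := cL _ _ uL' y2L.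
    exists (u :: e); rewrite /= syma uv ue; split=> //.
    by apply: sub => y; rewrite inE => /predU1P[->//|/eL].
  + have [e [ue le eL]] := cL _ _ y1L uL'.
    exists (rcons e v); rewrite rcons_path last_rcons ue le uv; split=> //.
    move=> y; rewrite mem_rcons inE => /predU1P[->|/eL yL].
      by rewrite mem_rcons mem_head.
    by rewrite mem_rcons inE yL orbT.
  + by have [e [ue le eL]] := cL _ _ y1L y2L; exists e; split=> //; apply: sub.
- move=> i j; rewrite size_rcons ltnS => /andP[ji].
  rewrite leq_eqVlt => /predU1P[iL|iL]; last first.
    rewrite (ltn_eqF iL) !nth_rcons iL (ltn_trans ji iL).
    have [lt pth] := HL i j ltac:(by rewrite ji).
    by rewrite (ltn_trans lt iL).
  rewrite iL eqxx index_mem; split=> //.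
  rewrite !nth_rcons ltnn eqxx index_mem uL' nth_index // -iL ji.
  have jL : nth r L j \in L by rewrite mem_nth -?iL.
  have [e [ue le eL]] := cL _ _ uL' jL.
  case/shortenP: ue le => e' ue' /= un sub le.
  exists (u :: e'); rewrite /= syma uv ue'; split=> //.
    rewrite un andbT; apply/negP; rewrite inE => /predU1P[vu|/sub/eL vL'].
      by rewrite vu uL' in vL.
    by rewrite vL' in vL.
  by rewrite !inE eqxx orbT.
Qed.

(** There are at most [2 ^ k] bags, being distinct sets of nodes, and one empty root set is added.
    Shorter lists are padded with empty sets, so that the length depends on [k] alone. *)
Lemma decomposition_certificate (D : dag_tree_decomposition P) :
  exists q, certificate (2 ^ k).+1 (width D) q /\
    forall i v, i < (2 ^ k).+1 -> q i v < (2 ^ k).+1 + k.+1.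
Proof.
case: D => N r a tree rN Nsrc Ncov Ninter; rewrite /width /=.
have [L [par [uL LN HL]]] : exists (L : seq {set 'I_k}) (par : nat -> nat),
    [/\ uniq L, L =i N & forall i j, j < i < size L -> par i < i /\
      on_tree_path a (nth r L i) (nth r L j) (nth r L (par i))].
  exact: tree_order tree rN.
have szL : size L <= 2 ^ k.
  by rewrite -(card_uniqP uL) (leq_trans (max_card _)) // -cardsT -powersetT
    card_powerset cardsT card_ord.
(* Index 0 is the added root, the bags start at 1, and later indices fall on the default, the empty
   set. The first bag and the padding get parent 0. *)
pose B i := nth set0 (set0 :: L) i.
pose S i := reach_set P (B i).
pose p i := if (1 < i) && (i <= size L) then (par i.-1).+1 else 0.
(* Nodes of the bag are guessed freely; any other node of the set is entered by an arc from within
   the set, and one such predecessor is recorded. *)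
pose q i v := if insub v is Some v then
    if v \in S i then if v \in B i then v.+1
      else if [pick u | (u \in S i) && P u v] is Some u then u.+1 else 0
    else 0
  else p i.
have qE i (v : 'I_k) : q i v = if v \in S i then if v \in B i then v.+1
    else if [pick u | (u \in S i) && P u v] is Some u then u.+1 else 0
    else 0 by rewrite /q valK.
have qp i : q i k = p i by rewrite /q insubF // ltnn.
have BL i : 0 < i <= size L -> B i = nth r L i.-1.
  by case: i => // i; rewrite /B /= => iL; apply: set_nth_default.
have B0 i : ~~ (0 < i <= size L) -> B i = set0.
  rewrite /B; case: i => //= i iL; rewrite nth_default //; lia.
have S0 i : ~~ (0 < i <= size L) -> S i = set0.
  by move=> iL; rewrite /S /reach_set B0 // big_set0.
have BS i : B i \subset S i.
  apply/subsetP => v vB; apply/bigcupP; exists v => //.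
  by rewrite inE connect0.
have guess i (v : 'I_k) : v \in S i -> v \notin B i ->
    exists u : 'I_k, [/\ q i v = u.+1, P u v & u \in S i].
  move=> vS vB; rewrite qE vS (negPf vB).
  have [u uS] := reach_pred vS vB.
  case: pickP => [x /andP[xS xv]|/(_ u)]; first by exists x.
  by rewrite uS.
have csE i : cert_set q i = S i.
  apply/setP => v; rewrite inE; case: (boolP (v \in S i)) => vS; last first.
    by rewrite qE (negPf vS).
  case: (boolP (v \in B i)) => vB; first by rewrite qE vS vB.
  by have [u [-> _ _]] := guess i v vS vB.
have inP i j v : j < i -> v \in S i -> v \in S j -> v \in S (p i).
  move=> ji vi vj.
  have j0 : 0 < j <= size L.
    by rewrite -[_ && _]negbK; apply/negP => /S0 E; rewrite E inE in vj.
  have i0 : 0 < i <= size L.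
    by rewrite -[_ && _]negbK; apply/negP => /S0 E; rewrite E inE in vi.
  have [plt pth] := HL i.-1 j.-1 ltac:(lia).
  have inN x : 0 < x <= size L -> nth r L x.-1 \in N.
    move=> x0; have lt : x.-1 < size L by lia.
    by rewrite -LN; exact: mem_nth lt.
  have := Ninter _ _ _ (inN _ i0) (inN _ j0) pth; rewrite -!BL //.
  have -> : p i = (par i.-1).+1 by rewrite /p; case: ifP => //; lia.
  have -> : nth r L (par i.-1) = B (par i.-1).+1 by rewrite BL //=; lia.
  by move=> /subsetP; apply; rewrite inE vi.
exists q; split; first split.
- move=> i v _; rewrite csE => vS; rewrite /cert_source csE.
  case: (boolP (v \in B i)) => vB; first by rewrite qE vS vB eqxx.
  by move=> _; apply: guess.
- move=> i u v _; rewrite !csE => /bigcupP[s sB]; rewrite inE => su uv.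
  apply/bigcupP; exists s => //; rewrite inE.
  exact: connect_trans su (connect1 uv).
- move=> i /andP[i0 _]; rewrite qp /p; case: ifP => // /andP[i1 iL].
  by have [lt _] := HL i.-1 0 ltac:(lia); lia.
- by move=> i j v /andP[ji _]; rewrite qp !csE; apply: inP.
- by rewrite csE S0.
- move=> v; have [s sS sv] := source_above v.
  move: sS; rewrite -Ncov => /bigcupP[b bN sb].
  have bL : b \in L by rewrite LN.
  exists (index b L).+1; first by rewrite ltnS (leq_trans _ szL) // index_mem.
  rewrite csE; apply/bigcupP; exists s; last by rewrite inE.
  by rewrite /B /= nth_index.
- move=> i _; apply: leq_trans (_ : #|B i| <= _).
    apply/subset_leq_card/subsetP => v; rewrite inE => /eqP qv.
    have vS : v \in S i by rewrite -csE inE qv.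
    apply: contraT => vB; have [u [qu uv _]] := guess i v vS vB.
    (* A node recorded as its own predecessor would carry a loop, against acyclicity; so only nodes
       of the bag are free. *)
    have vu : u = v by apply: val_inj; move: qv; rewrite qu => -[].
    have : [:: v] = [::] by apply: acP; rewrite /= -{1}vu uv.
    by [].
  case: (boolP (0 < i <= size L)) => iL; last by rewrite B0 // cards0.
  have lt : i.-1 < size L by lia.
  have bN : B i \in N by rewrite BL // -LN; exact: mem_nth lt.
  by rewrite (bigD1 _ bN) /= leq_maxl.
- move=> i v iK; rewrite /q; case: insubP => [v' _ _|_].
    case: ifP => // _; case: ifP => _; first by have := ltn_ord v'; lia.
    by case: pickP => [u _|//]; have := ltn_ord u; lia.
  rewrite /p; case: ifP => // /andP[i1 iL].
  by have [lt _] := HL i.-1 0 ltac:(lia); lia.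
Qed.

End Certificates.

(** * Reading an adjacency list *)

Notation scalar a := (Cell a (Cst 0)).

Declare Scope term_scope.
Delimit Scope term_scope with T.
Notation "x + y" := (Op Plus x y) : term_scope.
Notation "x - y" := (Op Minus x y) : term_scope.
Notation "x * y" := (Op Times x y) : term_scope.
Notation "x / y" := (Op Over x y) : term_scope.
Notation "c1 ;; c2" := (Sq c1 c2) (at level 80, right associativity).
Notation "a <-- e" := (Asg a (Cst 0) e%T) (at level 75).
Notation "a @ i <-- e" := (Asg a i%T e%T) (at level 75, i at level 39).

Lemma wp_for_frame R W B big e c rho s (I : nat -> state -> Prop)
    (Q : state -> Prop) :
  safe_term R e rho s -> ev e rho s <= (if big then W else R) ->
  I 0 s ->
  (forall i s', i < ev e rho s -> (forall a, a \notin writes c -> s' a = s a) ->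
     I i s' -> wp R W B c (i :: rho) s' (I i.+1)) ->
  (forall s', (forall a, a \notin writes c -> s' a = s a) ->
     I (ev e rho s) s' -> Q s') ->
  wp R W B (For big e c) rho s Q.
Proof.
move=> se le I0 IS IQ.
pose I' i s' := (forall a, a \notin writes c -> s' a = s a) /\ I i s'.
apply: (wp_for (I := I')) => // [i s' iN [fr Ii]|s' [fr In]]; last exact: IQ.
apply: wp_mono (wp_frame (IS _ _ iN fr Ii)) _ => s'' [In fr'].
by split=> // a na; rewrite fr' ?fr.
Qed.

Lemma row_major_eq N x y x' y' : y < N -> y' < N ->
  (x * N + y == x' * N + y') = (x == x') && (y == y').
Proof.
move=> yN y'N; apply/eqP/andP => [E|[/eqP-> /eqP->] //].
have N0 : 0 < N by apply: leq_ltn_trans yN.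
have := congr1 (divn^~ N) E; have := congr1 (modn^~ N) E.
rewrite !modnMDl !modn_small // => ->.
by rewrite !divnMDl // !divn_small // !addn0 => ->.
Qed.

Notation a_pos := 3 (only parsing).

Ltac update_simpl :=
  rewrite /update /= ?eqxx;
  repeat match goal with
  | H : is_true (?x != ?y) |- _ =>
      progress rewrite ?(negPf H) ?[y == x]eq_sym ?(negPf H)
  end; rewrite /=.

(** [a_pos] is the input position, left where the next graph begins. The adjacency matrix is not
    initialised, which could take [n ^ 2] steps: cells are 0 at the start and only arcs are written.
    The truncated difference added to [amx] yields a maximum. *)
Definition read_graph (aN aadj anb amx : nat) : stmt :=
  aN <-- Cell 0 (scalar a_pos);;
  a_pos <-- scalar a_pos + Cst 1;;
  For true (scalar aN)
    (amx <-- scalar amx + (Cell 0 (scalar a_pos) - scalar amx);;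
     For false (Cell 0 (scalar a_pos))
       (aadj @ (Var 1 * scalar aN + Cell 0 (scalar a_pos + Cst 1 + Var 0))
          <-- Cst 1;;
        anb @ (Var 1 * scalar aN + Var 0)
          <-- Cell 0 (scalar a_pos + Cst 1 + Var 0));;
     a_pos <-- scalar a_pos + Cell 0 (scalar a_pos) + Cst 1).

Definition adjacency_code (LL : seq (seq nat)) : seq nat :=
  flatten [seq size l :: l | l <- LL].

(** The bound on [anb] covers all cells, also those outside the lists, because a guess may point
    beyond the end of a list. *)
Definition graph_read (LL : seq (seq nat)) (aN aadj anb amx : nat)
    (s : state) : Prop :=
  [/\ s aN 0 = size LL,
      forall x y, x < size LL -> y < size LL ->
        s aadj (x * size LL + y) = (y \in nth [::] LL x),
      forall x j, x < size LL -> j < size (nth [::] LL x) ->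
        s anb (x * size LL + j) = nth 0 (nth [::] LL x) j,
      forall t, s anb t <= size LL
    & s amx 0 = \max_(l <- LL) size l].

Lemma read_graphP R W B LL rest p0 (aN aadj anb amx : nat) rho s :
  uniq [:: 0; a_pos; aN; aadj; anb; amx] ->
  s a_pos 0 = p0 ->
  (forall i, s 0 (p0 + i) = nth 0 (size LL :: adjacency_code LL ++ rest) i) ->
  s aadj =1 (fun=> 0) -> s anb =1 (fun=> 0) -> s amx 0 = 0 ->
  (forall l, l \in LL -> [/\ size l <= size LL, size l <= R, size l <= B
    & forall y, y \in l -> y < size LL]) ->
  size LL <= W -> size LL <= B -> p0 + (size (adjacency_code LL)).+1 <= B ->
  wp R W B (read_graph aN aadj anb amx) rho s
    (fun s' => graph_read LL aN aadj anb amx s' /\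
       s' a_pos 0 = p0 + (size (adjacency_code LL)).+1).
Proof.
set N := size LL => un sp sin sadj snb smx HL NW NB pB.
move: un; rewrite /= !inE !negb_or => /and5P[].
case/and5P=> n01 n02 n03 n04 n05 /and4P[n11 n12 n13 n14].
case/and3P=> n21 n22 n23 /andP[n31 n32] /andP[n41 _].
pose blocks := [seq size l :: l | l <- LL].
pose L x := nth [::] LL x.
pose pos u := p0 + (size (flatten (take u blocks))).+1.
have posE u i : s 0 (pos u + i) = nth 0 (flatten (drop u blocks) ++ rest) i.
  rewrite /pos -addnA sin addSn /= /adjacency_code -/blocks.
  by rewrite -{1}(cat_take_drop u blocks) flatten_cat -catA nth_cat ltnNge
    leq_addr /= addKn.
have dropE u : u < N ->
    drop u blocks = (size (L u) :: L u) :: drop u.+1 blocks.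
  move=> uN; rewrite (drop_nth [::]) ?size_map // (nth_map [::]) //.
have degE u : u < N -> s 0 (pos u) = size (L u).
  by move=> uN; rewrite -[pos u]addn0 posE dropE.
have nbE u j : u < N -> j < size (L u) -> s 0 (pos u + 1 + j) = nth 0 (L u) j.
  move=> uN jL; rewrite -addnA posE dropE //= nth_cat.
  by rewrite size_cat ltn_addr // nth_cat jL.
have posS u : u < N -> pos u + size (L u) + 1 = pos u.+1.
  move=> uN; rewrite /pos (take_nth [::]) ?size_map //.
  rewrite flatten_rcons size_cat (nth_map [::]) //= -/(L u); lia.
have pos_le u : pos u <= B.
  apply: leq_trans pB; rewrite /pos leq_add2l ltnS /adjacency_code -/blocks.
  by rewrite -{2}(cat_take_drop u blocks) flatten_cat size_cat leq_addr.
have LP u : u < N -> [/\ size (L u) <= N, size (L u) <= R, size (L u) <= B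
    & forall y, y \in L u -> y < N].
  by move=> uN; apply: HL; apply: mem_nth.
apply: wp_seq; apply: wp_asg => //=; first by rewrite sp -[p0]addn0 sin.
rewrite sp -{1}[p0]addn0 sin /=.
apply: wp_seq; apply: wp_asg => //=.
  by update_simpl; rewrite sp; apply: leq_trans (pos_le 0); rewrite /pos; lia.
(* Rows before [u] are complete and row [u] holds its first [j] neighbours. *)
pose adj_at u j (t : state) := forall x y, x < N -> y < N ->
  t aadj (x * N + y) =
    (x < u) && (y \in L x) || (x == u) && (y \in take j (L x)) :> nat.
pose nb_at u j (t : state) := (forall i, t anb i <= N) /\
  forall x i, x < N -> i < size (L x) -> (x < u) || (x == u) && (i < j) ->
    t anb (x * N + i) = nth 0 (L x) i.
pose I u (t : state) := [/\ t a_pos 0 = pos u, t aN 0 = N,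
  t amx 0 = \max_(l <- take u LL) size l, adj_at u 0 t & nb_at u 0 t].
apply: (wp_for_frame (I := I)) => //=; first by update_simpl.
- split.
  + by update_simpl; rewrite sp addn1 /pos take0 addn1.
  + by update_simpl.
  + by update_simpl; rewrite smx take0 big_nil.
  + by move=> x y xN yN; update_simpl; rewrite sadj take0 andbF.
  + split=> [i|x i _ _]; first by update_simpl; rewrite snb.
    by rewrite ltn0 andbF.
- have -> : update (update s aN 0 N) 3 0 (update s aN 0 N 3 0 + 1) aN 0 = N.
    by update_simpl.
  move=> u t uN fr [tp tN tm tadj tnb].
  have t0 : t 0 = s 0.
    rewrite fr; last by rewrite !inE !negb_or n03 n04 n05.
    by update_simpl.
  have [l1 l2 l3 l4] := LP u uN.
  have tmE :
      t amx 0 + (t 0 (t 3 0) - t amx 0) = \max_(l <- take u.+1 LL) size l.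
    rewrite tp t0 degE // tm (take_nth [::]) // -cats1 big_cat big_seq1.
    by rewrite -/(L u) /= maxnE.
  have mxB x : \max_(l <- take x LL) size l <= B.
    apply/bigmax_leqP_seq => l lx _.
    by have [] := HL l (mem_take lx).
  apply: wp_seq; apply: wp_asg => //=; first by rewrite tmE.
  rewrite tmE; set t1 := update t amx 0 _.
  have t1N : t1 aN 0 = N by rewrite /t1; update_simpl.
  have t1p : t1 3 0 = pos u by rewrite /t1; update_simpl.
  have t10 : t1 0 = s 0 by rewrite -t0 /t1; update_simpl.
  pose J j (t' : state) := adj_at u j t' /\ nb_at u j t'.
  apply: wp_seq; apply: (wp_for_frame (I := J)) => //=.
  + by rewrite t1p t10 degE.
  + split.
      by move=> x y xN yN; rewrite /t1; update_simpl; rewrite tadj.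
    have [nb1 nb2] := tnb; split=> [i|x i xN iL]; rewrite /t1; update_simpl.
      exact: nb1.
    exact: nb2.
  + rewrite t1p t10 degE // => j t' jL fr' [adj' nb'].
    have [f0 fN fp] : [/\ t' 0 = s 0, t' aN 0 = N & t' 3 0 = pos u].
      by split; rewrite fr' // !inE !negb_or ?n03 ?n04 ?n21 ?n22 ?n12 ?n13.
    have nbu := nbE _ _ uN jL.
    have nbN : nth 0 (L u) j < N by apply/l4/mem_nth.
    apply: wp_seq; apply: wp_asg => //=; first lia.
    rewrite f0 fN fp nbu; set t2 := update t' aadj _ _.
    have [g0 gN gp] : [/\ t2 0 = s 0, t2 aN 0 = N & t2 3 0 = pos u].
      by rewrite /t2; split; update_simpl.
    apply: wp_asg => //=; rewrite g0 ?gN gp nbu; first lia.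
    split.
      move=> x y xN yN; rewrite /t2; update_simpl.
      rewrite row_major_eq // adj' //.
      case: (eqVneq x u) => [->|_] //=.
      rewrite ltnn (take_nth 0) // mem_rcons inE.
      by case: (y == _).
    have [nb1 nb2] := nb'; split=> [i|x i xN iL]; rewrite /t2; update_simpl.
      by case: ifP => _; [lia | apply: nb1].
    have [l1x _ _ _] := LP x xN.
    rewrite row_major_eq //; try lia.
    case: (eqVneq x u) => [xu|_] /=; last first.
      by rewrite orbF => xu; apply: nb2; rewrite ?xu.
    rewrite ltnS [i <= j]leq_eqVlt.
    case: (eqVneq i j) => [->|_] /=; first by rewrite xu.
    by move=> ij; apply: nb2; rewrite // (introT eqP xu).
  move=> t2 fr2; rewrite t1p t10 degE // => -[adj2 nb2].
  have [g0 gN gp gm] : [/\ t2 0 = s 0, t2 aN 0 = N, t2 3 0 = pos u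
      & t2 amx 0 = t1 amx 0].
    split; rewrite fr2 ?t10 // !inE !negb_or ?n03 ?n04 ?n21 ?n22 ?n12 ?n13 //.
    by rewrite eq_sym n32 eq_sym n41.
  apply: wp_asg => //=; rewrite g0 gp degE // posS //.
  split; update_simpl => //.
  + by rewrite gm /t1; update_simpl.
  + move=> x y xN yN; update_simpl; rewrite adj2 // take0 in_nil andbF orbF.
    have -> : (x < u.+1) = (x < u) || (x == u) by lia.
    case: (eqVneq x u) => [->|_] /=; last by rewrite !orbF.
    by rewrite ltnn take_size.
  + have [nb21 nb22] := nb2; split=> [i|x i xN iL]; update_simpl => //.
    rewrite ltn0 andbF orbF ltnS leq_eqVlt => /orP xu; apply: nb22 => //.
    by case: xu => [/eqP xu|->] //; rewrite xu eqxx -xu iL orbT.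
- have -> : update (update s aN 0 N) 3 0 (update s aN 0 N 3 0 + 1) aN 0 = N.
    by update_simpl.
  move=> t fr [tp tN tm tadj [tnb1 tnb2]]; split; last first.
    by rewrite tp /pos take_oversize // size_map.
  rewrite take_oversize // in tm; split=> // [x y xN yN|x j xN jL].
    by rewrite tadj // xN take0 in_nil andbF orbF.
  by rewrite tnb2 // xN.
Qed.

(** * Mixed radix expansions *)

Section MixedRadix.

Variable beta : nat -> nat.

Definition place (v : nat) : nat := \prod_(0 <= t < v) beta t.

Definition digit (x v : nat) : nat := (x %/ place v) %% beta v.

(** Terms above place [v] are multiples of [place v * beta v] and vanish from the digit; terms below
    it sum to less than [place v]. *)
Lemma digit_sum (g : nat -> nat) (K : nat) :
  (forall v, v < K -> g v < beta v) ->
  \sum_(0 <= t < K) g t * place t < place K /\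
  forall v, v < K -> digit (\sum_(0 <= t < K) g t * place t) v = g v.
Proof.
elim: K => [|K IH] gb; first by rewrite /place !big_geq.
rewrite big_nat_recr //=; set x := \sum_(_ <= _ < K) _ in IH *.
have [v vK|xK xd] := IH; first by apply: gb; lia.
have p0 : 0 < place K by lia.
have gK := gb K (ltnSn K).
split.
  rewrite /place big_nat_recr //= -/(place K); nia.
move=> v; rewrite ltnS leq_eqVlt => /predU1P[->|vK].
  by rewrite /digit addnC divnMDl // divn_small // addn0 modn_small.
rewrite -(xd v vK) /digit.
have pE : place K = place v * (beta v * \prod_(v.+1 <= t < K) beta t).
  rewrite /place (big_cat_nat (n := v)) //=; last exact: ltnW.
  by rewrite [X in _ * X]big_ltn.
have pv : 0 < place v by move: p0; rewrite pE muln_gt0 => /andP[].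
set r := \prod_(v.+1 <= t < K) _ in pE.
have -> : x + g K * place K = (g K * r * beta v) * place v + x.
  by rewrite pE; lia.
by rewrite divnMDl // modnMDl.
Qed.

Lemma digits_exist (g : nat -> nat) (K : nat) :
  (forall v, v < K -> g v < beta v) ->
  exists x, x < place K /\ forall v, v < K -> digit x v = g v.
Proof. by move=> /digit_sum H; eexists; exact: H. Qed.

End MixedRadix.

(** * Boolean terms *)

Notation "! e" := (Op Minus (Cst 1) e) (at level 35) : term_scope.

(** Nonzero means true. Both truncated differences vanish exactly for equal numbers; sums act as
    disjunctions, products as conjunctions, and sums over a range as existential quantifiers. *)
Definition t_eq (a b : term) : term := (! ((a - b) + (b - a)))%T.
Definition t_imp (a b : term) : term := (! a + b)%T.
Definition t_lt (a b : term) : term := (b - a)%T.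
Definition t_all (N e : term) : term := (! Big false N (! e))%T.

Definition holds (e : term) (rho : seq nat) (s : state) : bool :=
  ev e rho s != 0.

Lemma holds_not e rho s : holds (! e)%T rho s = ~~ holds e rho s.
Proof. by rewrite /holds /=; lia. Qed.

Lemma holds_eq a b rho s : holds (t_eq a b) rho s = (ev a rho s == ev b rho s).
Proof. by rewrite /holds /=; lia. Qed.

Lemma holds_imp a b rho s :
  holds (t_imp a b) rho s = holds a rho s ==> holds b rho s.
Proof. by rewrite /holds /=; case: (ev a rho s) => [|x] //=; lia. Qed.

Lemma holds_and a b rho s :
  holds (a * b)%T rho s = holds a rho s && holds b rho s.
Proof. by rewrite /holds /= muln_eq0 negb_or. Qed.

Lemma holds_or a b rho s :
  holds (a + b)%T rho s = holds a rho s || holds b rho s.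
Proof. by rewrite /holds /= addn_eq0 negb_and. Qed.

Lemma holds_lt a b rho s : holds (t_lt a b) rho s = (ev a rho s < ev b rho s).
Proof. by rewrite /holds /=; lia. Qed.

Lemma holds_exP N e rho s :
  reflect (exists2 i, i < ev N rho s & holds e (i :: rho) s)
          (holds (Big false N e) rho s).
Proof.
rewrite /holds /= big_mkord sum_nat_eq0 negb_forall.
apply: (iffP existsP) => [[i]|[i iN H]]; first by exists i.
by exists (Ordinal iN).
Qed.

Lemma holds_allP N e rho s :
  reflect (forall i, i < ev N rho s -> holds e (i :: rho) s)
          (holds (t_all N e) rho s).
Proof.
rewrite holds_not; apply: (iffP idP) => [H i iN|H].
  apply: contraR H => nH; apply/holds_exP; exists i => //.
  by rewrite holds_not.
by apply/holds_exP => -[i /H]; rewrite holds_not => ->.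
Qed.

Lemma ev_not e rho s : ev (! e)%T rho s = ~~ holds e rho s.
Proof. by rewrite /holds /=; case: (ev e rho s). Qed.

Lemma ev_all N e rho s : ev (t_all N e) rho s = holds (t_all N e) rho s.
Proof. by rewrite [LHS]ev_not -holds_not. Qed.

Lemma ev_eq a b rho s : ev (t_eq a b) rho s = (ev a rho s == ev b rho s).
Proof. by rewrite [LHS]ev_not -holds_not -/(t_eq a b) holds_eq. Qed.

Lemma ev_sum N e rho s :
  ev (Big false N e) rho s = \sum_(i < ev N rho s) ev e (nat_of_ord i :: rho) s.
Proof. by rewrite /= big_mkord. Qed.

Lemma ev_prod N e rho s :
  ev (Big true N e) rho s = \prod_(i < ev N rho s) ev e (nat_of_ord i :: rho) s.
Proof. by rewrite /= big_mkord. Qed.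

Lemma holds_ex_ordP k N e rho s : ev N rho s = k ->
  reflect (exists i : 'I_k, holds e (nat_of_ord i :: rho) s)
          (holds (Big false N e) rho s).
Proof.
move=> <-; apply: (iffP (holds_exP N e rho s)) => [[i iN H]|[i H]].
  by exists (Ordinal iN).
by exists i.
Qed.

Lemma holds_all_ordP k N e rho s : ev N rho s = k ->
  reflect (forall i : 'I_k, holds e (nat_of_ord i :: rho) s)
          (holds (t_all N e) rho s).
Proof.
move=> <-; apply: (iffP (holds_allP N e rho s)) => [H i|H i iN]; first exact: H.
exact: (H (Ordinal iN)).
Qed.

Lemma ev_cond e0 e1 e2 rho s : ev (Cond e0 e1 e2) rho s =
  if holds e0 rho s then ev e1 rho s else ev e2 rho s.
Proof. by rewrite /holds /=; case: eqP. Qed.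

Lemma ev_cell a e rho s : ev (Cell a e) rho s = s a (ev e rho s).
Proof. by []. Qed.

Lemma ev_op o e1 e2 rho s :
  ev (Op o e1 e2) rho s = op_fun o (ev e1 rho s) (ev e2 rho s).
Proof. by []. Qed.

(** A certificate is determined by its first [m] rows and [k.+1] columns, the part kept in memory;
    parents refer to earlier rows and never leave it. *)
Lemma certificate_ext k (P : rel 'I_k) m w q q' :
  0 < m -> (forall i v, i < m -> v <= k -> q i v = q' i v) ->
  certificate P m w q -> certificate P m w q'.
Proof.
move=> m0 E [c1 c2 c3 c4 c5 c6 c7].
have Eo i (v : 'I_k) : i < m -> q i v = q' i v.
  by move=> im; apply: E => //; apply: ltnW.
have Es i : i < m -> cert_set k q i = cert_set k q' i.
  by move=> im; apply/setP => v; rewrite !inE Eo.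
split.
- move=> i v im; rewrite -Es // /cert_source -Es // -Eo //; exact: c1.
- move=> i u v im; rewrite -Es //; exact: c2.
- by move=> i /andP[i0 im]; rewrite -E // c3 ?i0.
- move=> i j v /andP[ji im].
  have pm : q i k < m by have := c3 i ltac:(lia); lia.
  rewrite -(E i k) // -!Es //; last by lia.
  by apply: c4; rewrite ji.
- by rewrite -Es.
- by move=> v; have [i im vi] := c6 v; exists i; rewrite -?Es.
- move=> i im; apply: leq_trans (c7 i im); apply: subset_leq_card.
  by apply/subsetP => v; rewrite !inE -Eo.
Qed.

(** * Searching for a certificate *)

Notation a_k := 4 (only parsing).
Notation a_P := 5 (only parsing).
Notation a_m := 12 (only parsing).
Notation a_base := 13 (only parsing).
Notation a_size := 14 (only parsing).
Notation a_found := 15 (only parsing).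
Notation a_q := 16 (only parsing).
Notation a_w := 17 (only parsing).
Notation a_y := 18 (only parsing).

(** Rows have length [k + 1], the last column holding the parent. *)
Definition t_q (i v : term) : term := Cell a_q (i * (scalar a_k + Cst 1) + v)%T.

Definition t_arc (u v : term) : term := Cell a_P (u * scalar a_k + v)%T.

(** To be read with the node as variable 0 and the set index as variable 1; a quantifier shifts
    both. *)
Definition t_guess : term :=
  (t_eq (t_q (Var 1) (Var 0)) (Var 0 + Cst 1) +
   Big false (scalar a_k)
     (t_eq (t_q (Var 2) (Var 1)) (Var 0 + Cst 1) *
      (t_arc (Var 0) (Var 1) * t_q (Var 2) (Var 0))))%T.

Definition t_closed : term :=
  t_all (scalar a_k) (t_imp (t_arc (Var 1) (Var 0)) (t_q (Var 2) (Var 0))).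

Definition t_inter : term :=
  t_all (Var 1)
    (t_imp (t_q (Var 0) (Var 1)) (t_q (t_q (Var 2) (scalar a_k)) (Var 1))).

Definition t_width : term :=
  t_lt (Big false (scalar a_k) (t_eq (t_q (Var 1) (Var 0)) (Var 0 + Cst 1)%T))
    (scalar a_w + Cst 1)%T.

Definition t_valid : term :=
  (t_all (scalar a_m)
     (t_all (scalar a_k)
        (t_imp (t_q (Var 1) (Var 0)) (t_guess * (t_closed * t_inter))) *
      (t_imp (Var 0) (t_lt (t_q (Var 0) (scalar a_k)) (Var 0)) * t_width)) *
   (t_all (scalar a_k) (! t_q (Cst 0) (Var 0)) *
    t_all (scalar a_k) (Big false (scalar a_m) (t_q (Var 0) (Var 1)))))%T.

Definition memory_cert (k : nat) (s : state) (i v : nat) : nat :=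
  s a_q (i * k.+1 + v).

Section Validity.

Variables (k m w : nat) (P : rel 'I_k) (s : state).
Hypotheses (sk : s a_k 0 = k) (sm : s a_m 0 = m) (sw : s a_w 0 = w).
Hypothesis sP : forall u v : 'I_k, s a_P (u * k + v) = P u v.

Let q := memory_cert k s.

Lemma ev_t_q i v rho : ev (t_q i v) rho s = q (ev i rho s) (ev v rho s).
Proof. by rewrite /= sk addn1. Qed.

Lemma holds_t_q i v rho :
  holds (t_q i v) rho s = (q (ev i rho s) (ev v rho s) != 0).
Proof. by rewrite -ev_t_q. Qed.

Lemma holds_t_arc i j rho (u v : 'I_k) : ev i rho s = u -> ev j rho s = v ->
  holds (t_arc i j) rho s = P u v.
Proof. by move=> iu jv; rewrite /holds /= iu jv sk sP eqb0 negbK. Qed.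

Lemma t_guessP i (v : 'I_k) rho :
  reflect (cert_source P q i v) (holds t_guess [:: nat_of_ord v, i & rho] s).
Proof.
rewrite holds_or holds_eq ev_t_q /= addn1 /cert_source.
case: eqP => /= [_|/eqP nv]; first by constructor.
have ks r : ev (scalar a_k) r s = k by [].
apply: (iffP (holds_ex_ordP _ (ks _))) => [[u]|/(_ isT) [u [qu uv uS]]].
  rewrite !holds_and holds_eq (holds_t_arc (u := u) (v := v)) //.
  rewrite holds_t_q ev_t_q /= addn1 => /and3P[/eqP qu uv uS] _.
  by exists u; rewrite inE.
exists u; rewrite !holds_and holds_eq (holds_t_arc (u := u) (v := v)) //.
by rewrite holds_t_q ev_t_q /= addn1 qu uv eqxx; rewrite inE in uS.
Qed.

Lemma t_closedP i (v : 'I_k) rho :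
  reflect (forall u, P v u -> u \in cert_set k q i)
          (holds t_closed [:: nat_of_ord v, i & rho] s).
Proof.
have ks r : ev (scalar a_k) r s = k by [].
apply: (iffP (holds_all_ordP _ (ks _))) => H u.
  move=> vu; have := H u; rewrite holds_imp (holds_t_arc (u := v) (v := u)) //.
  by rewrite vu holds_t_q inE.
rewrite holds_imp (holds_t_arc (u := v) (v := u)) // holds_t_q.
by apply/implyP => /H; rewrite inE.
Qed.

Lemma t_interP i (v : 'I_k) rho :
  reflect (forall j, j < i -> v \in cert_set k q j ->
             v \in cert_set k q (q i k))
          (holds t_inter [:: nat_of_ord v, i & rho] s).
Proof.
apply: (iffP (holds_allP _ _ _ _)) => H j ji.
  move=> vj; have := H j ji; rewrite holds_imp !holds_t_q ev_t_q /= sk !inE.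
  by move: vj; rewrite inE => ->.
rewrite holds_imp !holds_t_q ev_t_q /= sk; apply/implyP => vj.
by have := H j ji; rewrite !inE; apply.
Qed.

Lemma holds_t_width i rho :
  holds t_width (i :: rho) s = (#|[set v : 'I_k | q i v == v.+1]| <= w).
Proof.
rewrite holds_lt ev_sum (_ : ev (scalar a_k) (i :: rho) s = k) //.
have -> : ev (scalar a_w + Cst 1)%T (i :: rho) s = w.+1 by rewrite /= sw addn1.
rewrite ltnS; congr (_ <= _).
rewrite -sum1_card [RHS]big_mkcond; apply: eq_bigr => v _.
rewrite inE -[LHS]/(ev (t_eq (t_q (Var 1) (Var 0)) (Var 0 + Cst 1)%T)
  [:: nat_of_ord v, i & rho] s).
by rewrite ev_eq ev_t_q /= addn1; case: eqP.
Qed.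

Lemma t_validP rho : holds t_valid rho s <-> certificate P m w q.
Proof.
have ks r : ev (scalar a_k) r s = k by [].
have ms r : ev (scalar a_m) r s = m by [].
rewrite /t_valid !holds_and; split.
  case/and3P=> /holds_allP H /(holds_all_ordP _ (ks _)) H0.
  move=> /(holds_all_ordP _ (ks _)) HC; rewrite ms in H.
  have Hv i (v : 'I_k) : i < m -> v \in cert_set k q i -> [/\
      cert_source P q i v, forall u, P v u -> u \in cert_set k q i
    & forall j, j < i -> v \in cert_set k q j -> v \in cert_set k q (q i k)].
    move=> /H; rewrite holds_and.
    move=> /andP[/(holds_all_ordP _ (ks _))/(_ v) Hv _].
    rewrite inE => vi; move: Hv; rewrite holds_imp holds_t_q vi !holds_and /=.
    by case/and3P=> /t_guessP ? /t_closedP ? /t_interP.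
  have Hi i : i < m -> (0 < i -> q i k < i) /\
      #|[set v : 'I_k | q i v == v.+1]| <= w.
    move=> /H; rewrite !holds_and holds_t_width holds_imp holds_lt ev_t_q.
    rewrite /holds /= sk => /and3P[_ lt ->]; split=> // i0.
    by move: lt; rewrite -lt0n i0.
  split.
  - by move=> i v im vi; have [] := Hv i v im vi.
  - by move=> i u v im ui uv; have [_ + _] := Hv i u im ui; apply.
  - by move=> i /andP[i0 im]; have [+ _] := Hi i im; apply.
  - move=> i j v /andP[ji im] vi vj; have [_ _ +] := Hv i v im vi.
    by move/(_ j ji vj).
  - apply/setP => v; rewrite !inE; have := H0 v.
    by rewrite holds_not holds_t_q => /negbTE.
  - move=> v; have /holds_exP[i] := HC v; rewrite ms holds_t_q => im vi.
    by exists i; rewrite // inE.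
  - by move=> i im; have [_] := Hi i im.
case=> c1 c2 c3 c4 c5 c6 c7; apply/and3P; split.
- apply/holds_allP => i; rewrite ms => im; rewrite !holds_and; apply/and3P.
  split.
  + apply/(holds_all_ordP _ (ks _)) => v; rewrite holds_imp holds_t_q.
    apply/implyP => vi; rewrite !holds_and.
    have vi' : v \in cert_set k q i by rewrite inE.
    apply/and3P; split; first exact/t_guessP/c1.
      by apply/t_closedP => u; apply: c2.
    by apply/t_interP => j ji; apply: c4; rewrite ?ji.
  + rewrite holds_imp holds_lt ev_t_q /holds /= sk -lt0n.
    by apply/implyP => i0; apply: c3; rewrite i0.
  + by rewrite holds_t_width c7.
- apply/(holds_all_ordP _ (ks _)) => v; rewrite holds_not holds_t_q.
  by move/setP/(_ v): c5; rewrite !inE /= => ->.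
- apply/(holds_all_ordP _ (ks _)) => v; apply/holds_exP.
  have [i im vi] := c6 v; exists i; first by rewrite ms.
  by rewrite holds_t_q; rewrite inE in vi.
Qed.

Lemma safe_t_valid R rho : k <= R -> m <= R -> safe_term R t_valid rho s.
Proof.
move=> kR mR; rewrite /= sk sm.
repeat (move=> *; split => //); try lia.
Qed.

End Validity.

Definition t_mod (a b : term) : term := (a - (a / b) * b)%T.

Lemma ev_mod a b rho s : ev (t_mod a b) rho s = ev a rho s %% ev b rho s.
Proof. by rewrite /= {1}(divn_eq (ev a rho s) (ev b rho s)) addKn. Qed.

(* The width is the leading digit of a code, so the first valid code has
   minimal width. *)
Definition search : stmt :=
  a_m <-- Big true (scalar a_k) (Cst 2) + Cst 1;;
  a_base <-- scalar a_m + scalar a_k + Cst 1;;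
  a_size <-- Big true (scalar a_m * (scalar a_k + Cst 1)) (scalar a_base);;
  For false ((scalar a_k + Cst 1) * scalar a_size)%T
    (a_y <-- Var 0;;
     a_w <-- scalar a_y / scalar a_size;;
     For false (! scalar a_found * (scalar a_m * (scalar a_k + Cst 1)))%T
       (a_q @ Var 0 <--
          t_mod (scalar a_y / Big true (Var 0) (scalar a_base))
            (scalar a_base));;
     a_found <-- scalar a_found + ! scalar a_found * ! ! t_valid).

(** * Numbers coding certificates *)

Definition num_sets (k : nat) : nat := (2 ^ k).+1.
Definition cert_base (k : nat) : nat := num_sets k + k.+1.
Definition cert_space (k : nat) : nat :=
  k.+1 * cert_base k ^ (num_sets k * k.+1).

Definition coded_cert (k y i v : nat) : nat :=
  digit (fun=> cert_base k) y (i * k.+1 + v).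

Lemma place_const b v : place (fun=> b) v = b ^ v.
Proof. by rewrite /place prod_nat_const_nat subn0. Qed.

(** The code writes [w] above the digits of [q]. Adding a multiple of the top place leaves the lower
    digits unchanged, and [w <= k] keeps the code within [cert_space]. *)
Lemma coded_cert_exists k (P : rel 'I_k) w q :
  w <= k -> certificate P (num_sets k) w q ->
  (forall i v, i < num_sets k -> q i v < cert_base k) ->
  exists y, [/\ y < cert_space k, y %/ cert_base k ^ (num_sets k * k.+1) = w
    & certificate P (num_sets k) w (coded_cert k y)].
Proof.
move=> wk cq qb; set N := num_sets k * k.+1.
have [|x [xN xd]] := @digits_exist (fun=> cert_base k)
    (fun t => q (t %/ k.+1) (t %% k.+1)) N.
  by move=> t tN; apply: qb; rewrite ltn_divLR.
rewrite place_const in xN.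
have b0 : 0 < cert_base k ^ N by lia.
exists (w * cert_base k ^ N + x); split.
- rewrite /cert_space -/N; nia.
- by rewrite divnMDl // divn_small // addn0.
apply: certificate_ext cq => // i v im vk.
have tN : i * k.+1 + v < N by rewrite /N; nia.
rewrite /coded_cert /digit place_const.
have -> : w * cert_base k ^ N + x =
    (w * cert_base k ^ (N - (i * k.+1 + v)).-1 * cert_base k) *
    cert_base k ^ (i * k.+1 + v) + x.
  rewrite -!mulnA -expnS -expnD; congr (_ * _ ^ _ + _); lia.
rewrite divnMDl ?modnMDl; last by rewrite expn_gt0 /cert_base addnS.
have := xd _ tN; rewrite /digit place_const => ->.
by rewrite divnMDl // divn_small // addn0 modnMDl modn_small.
Qed.

(** [y0] codes a certificate of width [w], so the scan accepts some [y' <= y0], whose leading digit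
    [y' %/ X] is at most [w]. The certificate left in memory need not be the given one. *)
Lemma searchP R W B k (P : rel 'I_k) w q rho s :
  s a_k 0 = k -> (forall u v : 'I_k, s a_P (u * k + v) = P u v) ->
  s a_found 0 = 0 ->
  w <= k -> certificate P (num_sets k) w q ->
  (forall i v, i < num_sets k -> q i v < cert_base k) ->
  cert_space k <= R -> num_sets k * k.+1 <= R -> cert_base k <= R -> R <= B ->
  wp R W B search rho s (fun s' =>
    s' a_m 0 = num_sets k /\
    exists2 w', w' <= w & certificate P (num_sets k) w' (memory_cert k s')).
Proof.
move=> sk sP sf wk cq qb R1 R2 R3 RB.
have [y0 [y0Y y0w cy0]] := coded_cert_exists wk cq qb.
set X := cert_base k ^ (num_sets k * k.+1) in y0w.
have kR : k <= R by move: R3; rewrite /cert_base; lia.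
have mR : num_sets k <= R by move: R3; rewrite /cert_base; lia.
have X0 : 0 < X by rewrite expn_gt0 /cert_base addnS.
have XR : X <= R by apply: leq_trans R1; rewrite /cert_space leq_pmull.
have mE : \prod_(0 <= i < k) 2 + 1 = num_sets k.
  by rewrite prod_nat_const_nat subn0 addn1.
apply: wp_seq; apply: wp_asg => //=; rewrite sk ?mE //; first lia.
set s1 := update s _ _ _.
have bE : s1 a_m 0 + s1 a_k 0 + 1 = cert_base k.
  by rewrite /s1 /update /= sk -addnA addn1.
apply: wp_seq; apply: wp_asg => //=; rewrite ?bE //; first lia.
set s2 := update s1 _ _ _.
have s2m : s2 a_m 0 = num_sets k by [].
have s2b : s2 a_base 0 = cert_base k by [].
have s2k : s2 a_k 0 = k by [].
have XE : \prod_(0 <= i < s2 12 0 * (s2 4 0 + 1)) s2 13 0 = X.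
  by rewrite prod_nat_const_nat subn0 s2m s2b s2k addn1.
apply: wp_seq; apply: wp_asg => //=; rewrite ?XE; try lia.
  by split; rewrite ?s2m ?s2k ?addn1.
set s3 := update s2 _ _ _.
have s3m : s3 a_m 0 = num_sets k by [].
have s3b : s3 a_base 0 = cert_base k by [].
have s3k : s3 a_k 0 = k by [].
have s3X : s3 a_size 0 = X by [].
have s3P (u v : 'I_k) : s3 a_P (u * k + v) = P u v by rewrite -sP.
have s3f : s3 a_found 0 = 0 by [].
clearbody s3; clear s1 s2 bE s2m s2b s2k XE.
pose good y := certificate P (num_sets k) (y %/ X) (coded_cert k y).
pose I y (t : state) :=
  (t a_found 0 = 0 /\ forall y', y' < y -> ~ good y') \/
  (t a_found 0 = 1 /\ exists2 y', y' <= y0 &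
     certificate P (num_sets k) (y' %/ X) (memory_cert k t)).
have g0 : good y0 by rewrite /good y0w.
apply: (wp_for_frame (I := I)) => //=.
- by rewrite s3k s3X addn1 -/(cert_space k).
- by left; split.
- rewrite s3k s3X => y t yY fr It.
  have f a : a \notin [:: a_y; a_w; a_q; a_found] -> t a = s3 a.
    by move=> na; apply: fr.
  have yB : y < B by move: R1; rewrite /cert_space -/X; lia.
  apply: wp_seq; apply: wp_asg => //=; first lia.
  set t1 := update t _ _ _.
  have t1X : t1 a_size 0 = X by rewrite /t1 /update /= f.
  apply: wp_seq; apply: wp_asg => //=; rewrite t1X.
    by apply: leq_trans (leq_div _ _) _; apply: ltnW.
  set t2 := update t1 _ _ _.
  have [t2k t2m t2b] : [/\ t2 a_k 0 = k, t2 a_m 0 = num_sets k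
      & t2 a_base 0 = cert_base k].
    by split; rewrite /t2 /t1 /update /= f.
  have t2w : t2 a_w 0 = y %/ X by [].
  have t2y : t2 a_y 0 = y by [].
  have t2f : t2 a_found 0 = t a_found 0 by [].
  have t2q : t2 a_q = t a_q by [].
  have t2P (u v : 'I_k) : t2 a_P (u * k + v) = P u v.
    by rewrite /t2 /t1 /update /= f.
  clearbody t2; clear t1 t1X.
  (* Once a code has been accepted, the factor [! scalar a_found] makes this loop empty, so the
     accepted certificate stays in memory. *)
  pose J j (t' : state) := forall i, i < num_sets k * k.+1 ->
    t' a_q i = if (t a_found 0 == 0) && (i < j)
               then digit (fun=> cert_base k) y i else t a_q i.
  apply: wp_seq; apply: (wp_for_frame (I := J)) => //=.
  + rewrite t2f t2m t2k addn1; case: (t a_found 0) => [|x] /=; last by [].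
    by rewrite mul1n.
  + by move=> i _; rewrite andbF t2q.
  + rewrite t2f t2m t2k addn1 => i t' iN fr' Ji.
    have f' a : a != a_q -> t' a = t2 a by move=> na; apply: fr'; rewrite inE.
    have fd : t a_found 0 = 0 by case: (t a_found 0) iN.
    have iN' : i < num_sets k * k.+1 by rewrite fd mul1n in iN.
    have dE : ev (t_mod (scalar a_y / Big true (Var 0) (scalar a_base))
        (scalar a_base))%T (i :: y :: rho) t' = digit (fun=> cert_base k) y i.
      rewrite ev_mod /= prod_nat_const_nat subn0 !f' // t2y t2b.
      by rewrite /digit place_const.
    apply: wp_asg; rewrite ?dE //=.
    * by do ! split=> //; lia.
    * rewrite /digit; apply: leq_trans RB; apply: leq_trans R3.
      by apply/ltnW/ltn_pmod; rewrite /cert_base addnS.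
    * move=> j jN; rewrite /update /= Ji // fd /=.
      have -> : (j < i.+1) = (j == i) || (j < i) by lia.
      by case: eqP => [->|_].
  move=> t' fr'; rewrite t2f t2m t2k addn1 => Jt.
  have f' a : a != a_q -> t' a = t2 a by move=> na; apply: fr'; rewrite inE.
  have [t'k t'm t'w t'f] : [/\ t' a_k 0 = k, t' a_m 0 = num_sets k,
      t' a_w 0 = y %/ X & t' a_found 0 = t a_found 0].
    by split; rewrite f'.
  have t'P (u v : 'I_k) : t' a_P (u * k + v) = P u v by rewrite f'.
  have vP := t_validP t'k t'm t'w t'P (y :: rho).
  have vE : ev (! ! t_valid)%T (y :: rho) t' = holds t_valid (y :: rho) t'.
    by rewrite ev_not holds_not negbK.
  have eE : ev (scalar a_found + ! scalar a_found * ! ! t_valid)%T (y :: rho) t'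
      = t a_found 0 + (1 - t a_found 0) * holds t_valid (y :: rho) t'.
    by rewrite -vE /= t'f.
  apply: wp_asg => //.
  + by do 4! split=> //; apply: safe_t_valid t'k t'm t'w _ _ kR mR.
  + rewrite eE; case: It => -[-> _]; case: (holds _ _ _) => //; lia.
  rewrite eE; set t3 := update t' _ _ _.
  case: It => [[fd ng]|[fd [y' y'0 cy']]]; last first.
    right; rewrite /t3 /update /= fd; split=> //; exists y' => //.
    apply: certificate_ext cy' => // i v im vk.
    rewrite /memory_cert /= Jt ?fd //; nia.
  have cE i v : i < num_sets k -> v <= k ->
      memory_cert k t' i v = coded_cert k y i v.
    move=> im vk; have lt : i * k.+1 + v < num_sets k * k.+1 by nia.
    by rewrite /memory_cert Jt // fd mul1n lt.
  case: (boolP (holds t_valid (y :: rho) t')) => hv.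
    right; rewrite /t3 /update /= fd hv; split=> //.
    exists y; last exact: (proj1 vP hv).
    rewrite leqNgt; apply/negP => lt; exact: ng lt g0.
  left; rewrite /t3 /update /= fd (negPf hv); split=> // y'.
  rewrite ltnS leq_eqVlt => /predU1P[->|]; last exact: ng.
  move=> gy; case/negP: hv; apply: (proj2 vP).
  apply: certificate_ext gy => // i v im vk.
  by rewrite cE.
move=> t fr; rewrite s3k s3X addn1 => It; split.
  by rewrite fr.
case: It => [[_ ng]|[_ [y' le cy']]]; first by case: (ng y0).
by exists (y' %/ X) => //; rewrite -y0w leq_div2r.
Qed.

(** * Running the dynamic program *)

Notation a_n := 8 (only parsing).
Notation a_G := 9 (only parsing).
Notation a_nb := 10 (only parsing).
Notation a_deg := 11 (only parsing).
Notation a_i := 19 (only parsing).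
Notation a_x := 20 (only parsing).
Notation a_F := 21 (only parsing).
Notation a_seen := 22 (only parsing).
Notation a_D := 23 (only parsing).
Notation a_new := 24 (only parsing).

(** The base [d + 1] is positive even for [d = 0], which leaves room for the digit 0 at nodes
    outside the set. *)
Definition t_beta (v : term) : term :=
  Cond (t_eq (t_q (scalar a_i) v) (v + Cst 1)%T)
    (scalar a_n) (scalar a_deg + Cst 1)%T.

Definition t_digit (v : term) : term :=
  t_mod (scalar a_x / Big true v (t_beta (Var 0)))%T (t_beta v).

Definition t_value (v : term) : term :=
  Cond (t_q (scalar a_i) v)
    (Cond (t_eq (t_q (scalar a_i) v) (v + Cst 1)%T)
       (t_digit v + Cst 1)%T
       (Cell a_nb ((Cell a_F (t_q (scalar a_i) v - Cst 1) - Cst 1) * scalar a_n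
          + t_digit v) + Cst 1)%T)
    (Cst 0).

(** A number may code no homomorphism at all, so the map it produces is tested in full. The range
    test matters: a stray cell of [a_nb] is only known to be at most [n], which allows an image as
    large as [n + 1]. *)
Definition t_hom_at : term :=
  (t_lt (Cell a_F (Var 0)) (scalar a_n + Cst 1) *
   (t_eq (! Cell a_F (Var 0)) (! t_q (scalar a_i) (Var 0)) *
    t_all (scalar a_k)
      (t_imp (t_q (scalar a_i) (Var 1))
        (t_imp (t_arc (Var 1) (Var 0))
          (Cell a_G ((Cell a_F (Var 1) - Cst 1) * scalar a_n
            + (Cell a_F (Var 0) - Cst 1)))))))%T.

Definition t_hom : term := t_all (scalar a_k) t_hom_at.

Definition t_code (e : term) : term :=
  Big false (scalar a_k)
    (Cond e (Cell a_F (Var 0) * Big true (Var 0) (scalar a_n + Cst 1))%T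
       (Cst 0)).

Definition t_shared (j : term) : term :=
  (t_q j (Var 0) * t_q (t_q j (scalar a_k)) (Var 0))%T.

(** Interleaving the [m] tables keeps their addresses apart without any bound on the codes. *)
Definition t_entry (e i : term) : term := (t_code e * scalar a_m + i)%T.

Definition t_weight : term :=
  Big true (scalar a_m)
    (Cond (t_lt (scalar a_i) (Var 0) *
           t_eq (t_q (Var 0) (scalar a_k)) (scalar a_i))%T
       (Cell a_D (t_entry (t_shared (Var 1)) (Var 0))) (Cst 1)).

(* [k] rounds evaluate the guesses coded by [x] whatever the order of the
   nodes.  Several [x] may code the same map, hence the table [a_seen]. *)
Definition dp_step : stmt :=
  a_x <-- Var 0;;
  For false (scalar a_k)
    (For false (scalar a_k) (a_F @ Var 0 <-- t_value (Var 0)));;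
  a_new <-- t_hom * ! Cell a_seen (t_entry (Cst 1) (scalar a_i));;
  a_D @ t_entry (t_shared (scalar a_i)) (scalar a_i) <--
    Cell a_D (t_entry (t_shared (scalar a_i)) (scalar a_i))
      + scalar a_new * t_weight;;
  a_seen @ t_entry (Cst 1) (scalar a_i) <--
    Cell a_seen (t_entry (Cst 1) (scalar a_i)) + scalar a_new.

Definition dp : stmt :=
  For false (scalar a_m)
    (a_i <-- scalar a_m - (Var 0 + Cst 1);;
     For true (Big true (scalar a_k) (t_beta (Var 0))) dp_step);;
  1 <-- Cell a_D (Cst 0).

Section DynamicProgram.

Variables (R W B k n d m w : nat) (P : rel 'I_k) (G : rel 'I_n).
Variables (q : nat -> nat -> nat) (nbl : nat -> seq nat).
Hypothesis acP : acyclic P.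
Hypothesis certq : certificate P m w q.
Hypothesis nblP : forall x y : 'I_n, (nat_of_ord y \in nbl x) = G x y.
Hypothesis nbl_size : forall x, size (nbl x) <= d.

Notation pmap := {ffun 'I_k -> 'I_n.+1}.

Definition context (t : state) : Prop :=
  [/\ [/\ t a_k 0 = k, t a_m 0 = m, t a_n 0 = n & t a_deg 0 = d],
      forall i v, memory_cert k t i v = q i v,
      forall u v : 'I_k, t a_P (u * k + v) = P u v,
      forall x y : 'I_n, t a_G (x * n + y) = G x y
    & (forall (x : 'I_n) j, j < size (nbl x) ->
         t a_nb (x * n + j) = nth 0 (nbl x) j) /\
      forall x, t a_nb x <= n].

Lemma context_eq t t' :
  (forall a, a \notin [:: a_i; a_x; a_F; a_seen; a_D; a_new] -> t' a = t a) ->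
  context t -> context t'.
Proof.
move=> f [[c1 c2 c3 c4] c5 c6 c7 [c8 c9]].
split; [split| | | |split] => [|||| i v|u v|x y|x j jl|x];
  by rewrite /memory_cert f // ?c6 ?c7 ?c8 ?c9 // -c5.
Qed.

Definition arc_up (a b : 'I_n.+1) : bool :=
  if unlift ord0 a is Some x then
    if unlift ord0 b is Some y then G x y else false
  else false.

Lemma arc_up_lift x y : arc_up (lift ord0 x) (lift ord0 y) = G x y.
Proof. by rewrite /arc_up !liftK. Qed.

Let S i : {set 'I_k} := cert_set k q i.
Let shared j := S j :&: S (q j k).
Let H i : {set pmap} := homs P arc_up (S i).

Definition map_code (f : pmap) : nat := \sum_(v < k) f v * n.+1 ^ v.

(* Partial maps as functions on nat, with the junk value 0 outside [k]. *)
Definition nat_map (f : pmap) (v : nat) : nat :=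
  if insub v is Some v then nat_of_ord (f v) else 0.

Lemma nat_mapE f (v : 'I_k) : nat_map f v = f v.
Proof. by rewrite /nat_map valK. Qed.

Lemma nat_map_lt f v : nat_map f v < n.+1.
Proof. by rewrite /nat_map; case: insub => [v'|]. Qed.

Lemma map_code_inj : injective map_code.
Proof.
have E f : map_code f =
    \sum_(0 <= v < k) nat_map f v * place (fun=> n.+1) v.
  rewrite big_mkord; apply: eq_bigr => v _.
  by rewrite nat_mapE place_const.
move=> f g fg; apply/ffunP => v; apply: val_inj; rewrite /= -!nat_mapE.
have dig h : digit (fun=> n.+1) (map_code h) v = nat_map h v.
  rewrite E; have [|_] := @digit_sum (fun=> n.+1) (nat_map h) k.
    by move=> u _; apply: nat_map_lt.
  by apply.
by rewrite -!dig fg.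
Qed.

Definition beta (i v : nat) : nat := if q i v == v.+1 then n else d.+1.

(** Inverse to [t_value]: the digits from which evaluation recovers [f]. A derived image is given by
    its position in the neighbour list of the image of the recorded predecessor. *)
Definition guess (i : nat) (f : pmap) (v : nat) : nat :=
  if q i v == 0 then 0
  else if q i v == v.+1 then (nat_map f v).-1
  else index (nat_map f v).-1 (nbl (nat_map f (q i v).-1).-1).

Lemma homs_lift i f (v : 'I_k) : f \in H i -> v \in S i ->
  exists x : 'I_n, f v = lift ord0 x.
Proof.
move=> /homsP[fS _] vS; have := fS v; rewrite vS.
by case: (unliftP ord0 (f v)) => [x -> _|->]; [exists x | rewrite eqxx].
Qed.

Lemma guess_lt i f v : i < m -> f \in H i -> v < k -> guess i f v < beta i v.
Proof.
move=> im fH vk; rewrite /guess /beta.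
have vE : v = Ordinal vk by [].
case: eqP => [-> //|/eqP q0].
have vS : Ordinal vk \in S i by rewrite inE.
have [x fx] := homs_lift fH vS.
case: eqP => [_|/eqP nv]; first by rewrite vE nat_mapE fx lift0 /=.
by rewrite ltnS (leq_trans (index_size _ _)).
Qed.

Lemma guess_exists i f : i < m -> f \in H i ->
  exists2 x, x < \prod_(0 <= v < k) beta i v
    & forall v, v < k -> digit (beta i) x v = guess i f v.
Proof.
move=> im fH; have [x [xk xd]] := digits_exist (fun v => @guess_lt i f v im fH).
by exists x.
Qed.

Definition represents (t : state) (f : pmap) : Prop :=
  forall v : 'I_k, t a_F v = f v.

Lemma ev_t_q_cert t i v rho :
  context t -> ev (t_q i v) rho t = q (ev i rho t) (ev v rho t).
Proof. by case=> [[c1 _ _ _] c2 _ _ _]; rewrite (ev_t_q c1) c2. Qed.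

Lemma ev_t_beta t i v rho :
  context t -> t a_i 0 = i -> ev (t_beta v) rho t = beta i (ev v rho t).
Proof.
move=> ct ti; have [[_ _ tn td] _ _ _ _] := ct.
rewrite /t_beta ev_cond holds_eq ev_t_q_cert //.
rewrite -[ev (scalar a_i) _ _]/(t a_i 0).
by rewrite ti /beta /= addn1 tn td addn1.
Qed.

Lemma ev_t_digit t i v rho x :
  context t -> t a_i 0 = i -> t a_x 0 = x ->
  ev (t_digit v) rho t = digit (beta i) x (ev v rho t).
Proof.
move=> ct ti tx; rewrite /t_digit ev_mod (ev_t_beta _ _ ct ti) /digit.
rewrite ev_op -[ev (scalar a_x) rho t]/(t a_x 0) tx ev_prod /place big_mkord.
congr (_ %/ _ %% _).
by apply: eq_bigr => u _; rewrite (ev_t_beta _ _ ct ti).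
Qed.

Lemma t_homP t i rho : context t -> t a_i 0 = i -> i < m ->
  reflect (exists2 f, f \in H i & represents t f) (holds t_hom rho t).
Proof.
move=> ct ti im; have [[tk tm tn td] _ tP tG _] := ct.
have ks r : ev (scalar a_k) r t = k by [].
have is_ r : ev (scalar a_i) r t = i by [].
have hq v r : holds (t_q (scalar a_i) v) r t = (q i (ev v r t) != 0).
  by rewrite /holds ev_t_q_cert // is_.
have hF v r : holds (Cell a_F v) r t = (t a_F (ev v r t) != 0) by [].
apply: (iffP (holds_all_ordP _ (ks _))) => [hv|[f fH tf] v].
  have {}hv (v : 'I_k) : [/\ t a_F v < n.+1, (t a_F v != 0) = (v \in S i)
      & forall u : 'I_k, v \in S i -> P v u ->
          t a_G ((t a_F v - 1) * n + (t a_F u - 1)) != 0].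
    have := hv v; rewrite !holds_and holds_lt holds_eq !ev_not hF hq inE.
    case/and3P=> lt /eqP eq /(holds_all_ordP _ (ks _)) ar; split.
    - by move: lt; rewrite /= tn addn1.
    - by move: eq; rewrite /=; case: (_ == 0); case: (_ == 0).
    move=> u vS vu; have := ar u; rewrite !holds_imp hq.
    rewrite (holds_t_arc _ tP (u := v) (v := u)) // vu /= vS /holds /=.
    by rewrite tn.
  pose f : pmap := [ffun v : 'I_k => inord (t a_F v)].
  have fE (v : 'I_k) : f v = t a_F v :> nat.
    by rewrite ffunE inordK //; have [] := hv v.
  exists f; last by move=> v; rewrite fE.
  have f0 (v : 'I_k) : (f v != ord0) = (v \in S i).
    by rewrite -val_eqE /= fE; have [] := hv v.
  apply/homsP; split=> // v u vS vu; have [_ _ /(_ u vS vu)] := hv v.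
  have uS : u \in S i := cert_closed certq im vS vu.
  have := f0 v; rewrite vS; case: (unliftP ord0 (f v)) => [x fx _|-> /eqP //].
  have := f0 u; rewrite uS; case: (unliftP ord0 (f u)) => [y fy _|-> /eqP //].
  rewrite -!fE fx fy !lift0 !subn1 /= tG arc_up_lift.
  by case: (G x y).
have /homsP[fS fa] := fH.
rewrite !holds_and holds_lt holds_eq !ev_not hF hq; apply/and3P; split.
- by rewrite /= tf tn addn1.
- by have := fS v; rewrite inE /= tf -val_eqE /= => ->.
apply/(holds_all_ordP _ (ks _)) => u; rewrite !holds_imp hq.
rewrite (holds_t_arc _ tP (u := v) (v := u)) //.
apply/implyP => vS; apply/implyP => vu.
have {}vS : v \in S i by rewrite inE.
have uS : u \in S i := cert_closed certq im vS vu.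
have := fa _ _ vS vu; have [x fx] := homs_lift fH vS.
have [y fy] := homs_lift fH uS; rewrite fx fy arc_up_lift => xy.
by rewrite /holds /= !tf fx fy !lift0 !subn1 /= tn tG xy.
Qed.

Lemma rank_gt0 (v : 'I_k) : 0 < rank P v.
Proof. by apply/card_gt0P; exists v; rewrite inE connect0. Qed.

Lemma ev_t_code t f e rho : context t -> represents t f ->
  ev (t_code e) rho t =
  \sum_(v < k) (if holds e (nat_of_ord v :: rho) t then f v * n.+1 ^ v else 0).
Proof.
move=> [[tk _ tn _] _ _ _ _] tf.
rewrite ev_sum (_ : ev (scalar a_k) rho t = k) //; apply: eq_bigr => v _.
rewrite ev_cond; case: ifP => // _.
by rewrite /= tf prod_nat_const_nat subn0 tn addn1.
Qed.

Lemma ev_t_code_all t f rho : context t -> represents t f ->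
  ev (t_code (Cst 1)) rho t = map_code f.
Proof. by move=> ct tf; rewrite (ev_t_code _ _ ct tf). Qed.

Lemma ev_t_code_shared t f e rho j : context t -> represents t f ->
  (forall v, ev e (v :: rho) t = j) ->
  ev (t_code (t_shared e)) rho t = map_code (restr (shared j) f).
Proof.
move=> ct tf ej; rewrite (ev_t_code _ _ ct tf); apply: eq_bigr => v _.
have [[tk _ _ _] _ _ _ _] := ct.
rewrite ffunE holds_and /holds !ev_t_q_cert // !ej.
rewrite -[ev (scalar a_k) _ _]/(t a_k 0) tk -[ev (Var 0) _ _]/(nat_of_ord v).
by rewrite !inE; case: ifP.
Qed.

Definition weight_in (t : state) (i : nat) (f : pmap) : nat :=
  \prod_(j < m | (i < j) && (q j k == i))
     t a_D (map_code (restr (shared j) f) * m + j).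

Lemma ev_t_weight t i f rho : context t -> represents t f -> t a_i 0 = i ->
  ev t_weight rho t = weight_in t i f.
Proof.
move=> ct tf ti; have [[tk tm _ _] _ _ _ _] := ct.
rewrite ev_prod (_ : ev (scalar a_m) rho t = m) // [RHS]big_mkcond.
apply: eq_bigr => j _.
rewrite ev_cond holds_and holds_lt holds_eq ev_t_q_cert //.
rewrite -[ev (scalar a_i) _ _]/(t a_i 0) -[ev (scalar a_k) _ _]/(t a_k 0) ti tk.
rewrite -[ev (Var 0) _ _]/(nat_of_ord j); case: ifP => // _.
rewrite ev_cell ev_op ev_op (ev_t_code_shared ct tf (j := j)) //.
by rewrite -[ev (scalar a_m) _ _]/(t a_m 0) tm.
Qed.

Hypotheses (nB : n < B) (WB : W <= B) (kR : k <= R) (mR : m <= R).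

(** After round [r] the images of nodes of rank at most [r] are right: a recorded predecessor has
    smaller rank, so its image was right a round earlier. Ranks are at most [k], hence [k] rounds.
    Nothing is claimed when [x] codes no homomorphism. *)
Lemma valuesP t i x rho :
  context t -> t a_i 0 = i -> t a_x 0 = x -> i < m -> x < W ->
  wp R W B (For false (scalar a_k)
      (For false (scalar a_k) (a_F @ Var 0 <-- t_value (Var 0)))) rho t
    (fun t' => forall f, f \in H i ->
       (forall v, v < k -> digit (beta i) x v = guess i f v) ->
       represents t' f).
Proof.
move=> ct ti tx im xW; have [[tk tm tn _] _ _ _ [tnb tnb_le]] := ct.
pose good (Q : 'I_k -> Prop) (t' : state) := forall f, f \in H i ->
  (forall v, v < k -> digit (beta i) x v = guess i f v) ->
  forall v, Q v -> t' a_F v = f v.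
pose I r := good (fun v => rank P v <= r).
apply: (wp_for_frame (I := I)) => //=; first by rewrite tk.
- by move=> f _ _ v; rewrite leqNgt rank_gt0.
- rewrite tk => r t1 rk fr1 I1.
  (* Within a round, right values of rank at most [r] are merely recomputed, while nodes before [u]
     gain one rank. *)
  pose J u := good (fun v => rank P v <= r \/ v < u /\ rank P v <= r.+1).
  have f1 a : a != a_F -> t1 a = t a by move=> na; rewrite fr1 ?inE.
  apply: (wp_for_frame (I := J)) => //=; rewrite ?f1 ?tk //.
  + by move=> f fH fx v [vr|[//]]; apply: I1.
  + move=> u t2 uk fr2 J2.
    have f2 a : a != a_F -> t2 a = t a by move=> na; rewrite fr2 ?inE ?f1.
    have ct2 : context t2.
      by apply: context_eq ct => a na; apply: f2; apply: contraNneq na => ->.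
    have t2i : t2 a_i 0 = i by rewrite f2.
    have t2n : t2 a_n 0 = n by rewrite f2.
    have t2x : t2 a_x 0 = x by rewrite f2.
    have dE rho' : ev (t_digit (Var 0)) (u :: rho') t2 = digit (beta i) x u.
      exact: ev_t_digit.
    have qE rho' : ev (t_q (scalar a_i) (Var 0)) (u :: rho') t2 = q i u.
      by rewrite ev_t_q_cert // -t2i.
    have digit_le : digit (beta i) x u < B.
      apply: leq_ltn_trans (leq_mod _ _) _.
      apply: leq_ltn_trans (leq_div _ _) _; exact: leq_trans WB.
    have vE rho' : ev (t_value (Var 0)) (u :: rho') t2 =
      if q i u != 0 then
        if q i u == u.+1 then (digit (beta i) x u).+1
        else (t2 a_nb ((t2 a_F (q i u).-1).-1 * n + digit (beta i) x u)).+1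
      else 0.
      rewrite /t_value !ev_cond holds_eq /holds qE.
      rewrite -[ev (Var 0 + Cst 1)%T _ _]/(u + 1) addn1.
      rewrite [ev (t_digit _ + _)%T _ _]ev_op dE.
      rewrite [ev (Cell a_nb _ + _)%T _ _]ev_op ev_cell ev_op dE.
      rewrite ev_op ev_op ev_cell ev_op qE /= !addn1 !subn1 t2n.
      by [].
    apply: wp_asg.
    * by [].
    * have t2k : t2 4 0 = k by rewrite f2.
      by rewrite /=; do ! split=> //; lia.
    * rewrite vE; case: ifP => // _; case: ifP => // _.
      by rewrite f2 //; apply: leq_ltn_trans (tnb_le _) nB.
    rewrite vE => f fH fx v Hv; rewrite /update /=.
    case: eqP => [vu|/eqP vu]; last first.
      apply: J2 => //; case: Hv => [|[]]; first by left.
      by rewrite ltnS leq_eqVlt (negPf vu) /= => *; right.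
    have rv : rank P v <= r.+1 by case: Hv => [/leqW|[]].
    rewrite fx // /guess -vu.
    case: eqP => [qv|/eqP qv] /=.
      have vS : v \notin S i by rewrite inE qv.
      by rewrite (homs_out fH vS).
    have vS : v \in S i by rewrite inE.
    have [y fy] := homs_lift fH vS.
    case: eqP => [_|/eqP nv]; first by rewrite nat_mapE fy lift0.
    have [z [qz zv zS]] := cert_guess certq im vS nv.
    have [y' fz] := homs_lift fH zS.
    rewrite qz /= !nat_mapE (J2 f fH fx z); last first.
      by left; have := rank_lt acP zv; lia.
    rewrite fy fz !lift0 /= f2 //.
    have yy' : nat_of_ord y \in nbl y'.
      by have /homsP[_ /(_ _ _ zS zv)] := fH; rewrite fy fz arc_up_lift nblP.
    by rewrite tnb ?index_mem // nth_index.
  move=> t2 fr2 J2 f fH fx v vr; apply: J2 => //.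
  by right; rewrite ltn_ord.
- move=> t' fr; rewrite tk => Ik f fH fx v; apply: Ik => //; exact: rank_le.
Qed.

(** [seen] is a ghost set, the homomorphisms counted so far. Column [i] sums their weights, taken in
    the state [t0] before the loop; this is sound because weights read other columns only. The bound
    on [a_seen] concerns all codes, as junk maps address it too. *)
Definition invariant (i : nat) (t0 : state) (x : nat) (t : state) : Prop :=
  exists seen : {set pmap},
    [/\ seen \subset H i,
        forall f x', f \in H i -> x' < x ->
          (forall v, v < k -> digit (beta i) x' v = guess i f v) -> f \in seen,
        forall c, t a_D (c * m + i) =
          \sum_(f in seen | map_code (restr (shared i) f) == c)
             weight_in t0 i f,
        (forall f, f \in H i ->
           t a_seen (map_code f * m + i) = (f \in seen)) /\
        (forall c, t a_seen (c * m + i) <= 1)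
      & forall j c, j < m -> j != i ->
          t a_D (c * m + j) = t0 a_D (c * m + j) /\
          t a_seen (c * m + j) = t0 a_seen (c * m + j)].

Lemma weight_in_eq t t0 i f :
  (forall j c, j < m -> j != i -> t a_D (c * m + j) = t0 a_D (c * m + j)) ->
  weight_in t i f = weight_in t0 i f.
Proof.
move=> E; apply: eq_bigr => j /andP[ij _]; apply: E => //.
by rewrite gtn_eqF.
Qed.

Lemma dp_stepP i t0 x t rho M :
  context t -> t a_i 0 = i -> i < m -> x < W ->
  (forall f, f \in H i -> weight_in t0 i f <= M) -> #|H i| * M <= B -> 0 < B ->
  invariant i t0 x t ->
  wp R W B dp_step (x :: rho) t (invariant i t0 x.+1).
Proof.
move=> ct ti im xW wM MB B0 [seen [sH sx sD [ss ss1] so]].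
have xB : x <= B by apply: leq_trans WB; apply: ltnW.
apply: wp_seq; apply: wp_asg => //=; set t1 := update t _ _ _.
have ct1 : context t1.
  apply: context_eq ct => a; rewrite !inE !negb_or => /and3P[_ na _].
  by rewrite /t1 /update (negPf na).
apply: wp_seq.
apply: wp_mono (wp_frame (valuesP (x :: rho) ct1 _ _ im xW)) _ => //.
move=> t2 [t2r fr].
have f2 a : a != a_F -> t2 a = t1 a by move=> na; rewrite fr ?inE.
have ct2 : context t2.
  by apply: context_eq ct1 => a na; apply: f2; apply: contraNneq na => ->.
have t2i : t2 a_i 0 = i by rewrite f2.
have t2m : t2 a_m 0 = m by case: ct2 => -[].
have t2k : t2 a_k 0 = k by case: ct2 => -[].
have t2D : t2 a_D = t a_D by rewrite f2.
have t2s : t2 a_seen = t a_seen by rewrite f2.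
pose r := x :: rho.
have homP := t_homP r ct2 t2i im.
pose cv := ev (t_hom * ! Cell a_seen (t_entry (Cst 1) (scalar a_i)))%T r t2.
have cE : cv = holds t_hom r t2 *
    (1 - t a_seen (ev (t_code (Cst 1)) r t2 * m + i)).
  rewrite /cv ev_op [ev t_hom _ _]ev_all ev_op ev_cell ev_op ev_op.
  rewrite -[ev (scalar a_m) r t2]/(t2 a_m 0) -[ev (scalar a_i) r t2]/(t2 a_i 0).
  by rewrite t2m t2i t2s.
have cv1 : cv <= 1 by rewrite cE; case: (holds _ _ _); lia.
apply: wp_seq; apply: wp_asg.
- by [].
- by rewrite /=; do ! split=> //; lia.
- exact: leq_trans B0.
rewrite -/cv; set t3 := update t2 _ _ _.
have t3E a : a != a_new -> t3 a = t2 a.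
  by move=> na; rewrite /t3 /update (negPf na).
have ct3 : context t3.
  by apply: context_eq ct2 => a na; apply: t3E; apply: contraNneq na => ->.
have t3k : t3 a_k 0 = k by rewrite t3E.
have t3m : t3 a_m 0 = m by rewrite t3E.
have t3i : t3 a_i 0 = i by rewrite t3E.
have t3D : t3 a_D = t a_D by rewrite t3E.
have t3c : t3 a_new 0 = cv by [].
have t3s : t3 a_seen = t a_seen by rewrite t3E.
pose aD := ev (t_code (t_shared (scalar a_i))) r t3.
pose wv := ev t_weight r t3.
have aDE : ev (t_entry (t_shared (scalar a_i)) (scalar a_i)) r t3 = aD * m + i.
  by rewrite -[LHS]/(aD * t3 a_m 0 + t3 a_i 0) t3m t3i.
have vDE : ev (Cell a_D (t_entry (t_shared (scalar a_i)) (scalar a_i))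
    + scalar a_new * t_weight)%T r t3 = t a_D (aD * m + i) + cv * wv.
  by rewrite ev_op ev_cell aDE t3D ev_op -/wv.
have weight_eq f : weight_in t3 i f = weight_in t0 i f.
  by apply: weight_in_eq => j c jm ji; rewrite t3D; case: (so j c jm ji).
pose aS := ev (t_code (Cst 1)) r t2.
have new_seen f x' : f \in H i -> x' < x.+1 ->
    (forall v, v < k -> digit (beta i) x' v = guess i f v) ->
    f \in seen \/ represents t2 f.
  move=> fH; rewrite ltnS leq_eqVlt => /predU1P[->|lt] fx.
    by right; apply: t2r.
  by left; apply: sx fx.
have addr_eq c c' j : j < m ->
    (c * m + j == c' * m + i) = (c == c') && (j == i).
  by move=> jm; apply: row_major_eq.
have repr_code f : represents t2 f -> [/\ aS = map_code f,
    aD = map_code (restr (shared i) f) & wv = weight_in t0 i f].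
  move=> tf; have tf3 : represents t3 f by move=> v; rewrite t3E.
  split; first exact: ev_t_code_all.
    by apply: ev_t_code_shared => // v; rewrite -t3i.
  by rewrite /wv (ev_t_weight _ ct3 tf3 t3i) weight_eq.
have Hseen : \sum_(f in H i) weight_in t0 i f <= B.
  apply: leq_trans MB; rewrite -sum_nat_const.
  by apply: leq_sum => f; apply: wM.
(* If memory represents no homomorphism, or one already counted, then [cv = 0] and the set is
   unchanged; otherwise that homomorphism joins it with [cv = 1]. *)
have [seen' [s'H s'x s'D s's s's1]] : exists seen' : {set pmap},
  [/\ seen' \subset H i,
    forall f x', f \in H i -> x' < x.+1 ->
      (forall v, v < k -> digit (beta i) x' v = guess i f v) -> f \in seen',
    forall c, t a_D (c * m + i) + (c == aD) * (cv * wv) =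
      \sum_(f in seen' | map_code (restr (shared i) f) == c) weight_in t0 i f,
    forall f, f \in H i ->
      t a_seen (map_code f * m + i) + (map_code f == aS) * cv = (f \in seen')
    & forall c, t a_seen (c * m + i) + (c == aS) * cv <= 1].
  case: homP cE => [[f fH tf]|nf] cE; last first.
    have cv0 : cv = 0 by rewrite cE.
    exists seen; split=> // [f x' fH lt fx|c|f fH|c].
    - by case: (new_seen f x' fH lt fx) => // tf; case: nf; exists f.
    - by rewrite cv0 muln0 addn0.
    - by rewrite cv0 muln0 addn0 ss.
    - by rewrite cv0 muln0 addn0.
  have [aSE aDE' wvE] := repr_code f tf.
  have uniq_f g : represents t2 g -> g = f.
    move=> tg; apply/ffunP => v; apply: val_inj.
    by rewrite /= -tg -tf.
  rewrite -/aS aSE ss // mul1n in cE.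
  case: (boolP (f \in seen)) cE => fs cE.
    have cv0 : cv = 0 by rewrite cE.
    exists seen; split=> // [g x' gH lt gx|c|g gH|c].
    - by case: (new_seen g x' gH lt gx) => // /uniq_f->.
    - by rewrite cv0 muln0 addn0.
    - by rewrite cv0 muln0 addn0 ss.
    - by rewrite cv0 muln0 addn0.
  have {cE}cv_1 : cv = 1 by rewrite cE.
  exists (f |: seen); split.
  - by rewrite subUset sub1set fH.
  - move=> g x' gH lt gx; rewrite !inE.
    by case: (new_seen g x' gH lt gx) => [->|/uniq_f->]; rewrite ?eqxx ?orbT.
  - move=> c; rewrite sD cv_1 mul1n wvE aDE' [RHS]big_mkcondr big_setU1 //=.
    rewrite -big_mkcondr addnC eq_sym; congr (_ + _).
    by case: (_ == c); rewrite ?mul1n.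
  - move=> g gH; rewrite ss // cv_1 muln1 aSE (inj_eq map_code_inj) !inE.
    by case: (eqVneq g f) => [->|_]; rewrite ?(negPf fs) ?addn0.
  - move=> c; rewrite cv_1 muln1 aSE.
    case: eqP => [->|_]; last by rewrite addn0.
    by rewrite ss // (negPf fs).
apply: wp_seq; apply: wp_asg.
- by rewrite /=; do ! split=> //; lia.
- by rewrite /=; do ! split=> //; lia.
- rewrite vDE; have := s'D aD; rewrite eqxx mul1n => ->.
  apply: leq_trans Hseen; rewrite big_mkcondr /=.
  rewrite [X in X <= _]big_mkcond [X in _ <= X]big_mkcond.
  apply: leq_sum => f _; have := subsetP s'H f; case: (f \in seen') => // -> //.
  by case: ifP.
rewrite aDE vDE; set t4 := update t3 _ _ _.
have t4E a : a != a_D -> t4 a = t3 a.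
  by move=> na; rewrite /t4 /update (negPf na).
have aSE : ev (t_entry (Cst 1) (scalar a_i)) r t4 = aS * m + i.
  rewrite -[LHS]/(ev (t_code (Cst 1)) r t2 * t4 a_m 0 + t4 a_i 0).
  by rewrite !t4E // t3m t3i.
have vSE : ev (Cell a_seen (t_entry (Cst 1) (scalar a_i)) + scalar a_new)%T r t4
    = t a_seen (aS * m + i) + cv.
  by rewrite ev_op ev_cell aSE !t4E // t3s -t3c.
apply: wp_asg.
- have t4k : t4 4 0 = k by rewrite t4E.
  by rewrite /=; do ! split=> //; lia.
- have t4k : t4 4 0 = k by rewrite t4E.
  by rewrite /=; do ! split=> //; lia.
- by rewrite vSE; have := s's1 aS; rewrite eqxx mul1n => /leq_trans; apply.
rewrite aSE vSE; set t5 := update t4 _ _ _.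
have t5D j c : j < m ->
    t5 a_D (c * m + j) =
      t a_D (c * m + j) + ((c == aD) && (j == i)) * (cv * wv).
  move=> jm; rewrite /t5 /t4 /update /= addr_eq // t3D.
  by case: ifP => [/andP[/eqP-> /eqP->]|_]; rewrite ?mul1n ?mul0n ?addn0.
have t5s j c : j < m ->
    t5 a_seen (c * m + j) = t a_seen (c * m + j) + ((c == aS) && (j == i)) * cv.
  move=> jm; rewrite /t5 /update /= addr_eq // t4E // t3s.
  by case: ifP => [/andP[/eqP-> /eqP->]|_]; rewrite ?mul1n ?mul0n ?addn0.
exists seen'; split=> //.
- by move=> c; rewrite t5D // eqxx andbT s'D.
- split=> [f fH|c]; rewrite t5s // eqxx andbT; [exact: s's | exact: s's1].
- move=> j c jm ji; rewrite t5D // t5s // (negPf ji) !andbF !mul0n !addn0.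
  exact: so.
Qed.

(** * Size of the table entries, and the outer loop *)

Let A := n.+1 ^ k.
(** A set has at most [m] children and there are [A] partial maps, so an entry is at most
    [A * bound j.+1 ^ m]; the exponents satisfy [1 + m * e <= m.+1 * e] for [e >= 1]. *)
Let bound j := A ^ (m.+1 ^ (m - j)).

Hypotheses (RB : R <= B) (boundB : A ^ (m.+1 ^ m) <= B).
Hypothesis betaW : forall i, i < m -> \prod_(0 <= v < k) beta i v <= W.

Lemma A_gt0 : 0 < A. Proof. by rewrite expn_gt0. Qed.

Lemma bound_le i j : i <= j -> bound j <= bound i.
Proof.
move=> ij; apply: leq_pexp2l; first exact: A_gt0.
by apply: leq_pexp2l => //; lia.
Qed.

Lemma weight_in_le t i f : i < m ->
  (forall j c, i < j < m -> t a_D (c * m + j) <= bound j) ->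
  weight_in t i f <= bound i.+1 ^ m.
Proof.
move=> im le; rewrite /weight_in big_mkcond /=.
apply: leq_trans (_ : \prod_(j < m) bound i.+1 <= _).
  apply: leq_prod => j _; case: ifP => [/andP[ij _]|_].
    by apply: leq_trans (le _ _ _) (bound_le ij); rewrite ij /=.
  by rewrite expn_gt0 A_gt0.
by rewrite prod_nat_const card_ord.
Qed.

Lemma card_H_bound i : i < m -> #|H i| * bound i.+1 ^ m <= bound i.
Proof.
move=> im; apply: leq_trans (_ : A * bound i.+1 ^ m <= _).
  rewrite leq_mul2r; apply/orP; right.
  by rewrite (leq_trans (max_card _)) // card_ffun !card_ord.
rewrite /bound -expnM -expnS; apply: leq_pexp2l; first exact: A_gt0.
have -> : m - i = (m - i.+1).+1 by lia.
have : 0 < m.+1 ^ (m - i.+1) by rewrite expn_gt0.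
rewrite [m.+1 ^ _.+1]expnS; nia.
Qed.

Definition solved (t : state) (j : nat) : Prop := forall c,
  t a_D (c * m + j) =
    \sum_(f in H j | map_code (restr (shared j) f) == c) weight_in t j f /\
  t a_D (c * m + j) <= bound j.

Lemma solved_root t : 0 < m -> (forall j, j < m -> solved t j) ->
  t a_D 0 = hom P G.
Proof.
move=> m0 sol.
have below_all : below S m = setT.
  apply/setP => v; rewrite inE; have [i im vi] := cert_cover certq v.
  by apply/in_below; exists i.
rewrite -(card_homs_setT P arc_up_lift) -below_all.
pose Dm j f := t a_D (map_code f * m + j).
have Sc i : i < m -> closed_set P (S i).
  by move=> im u v uS uv; exact: (cert_closed certq im uS uv).
have Si i j v : j < i < m -> v \in S i -> v \in S j -> v \in S (q i k).
  by move=> ij vi vj; exact: (cert_inter certq ij vi vj).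
have De j f : j < m -> Dm j f = \sum_(g in homs P arc_up (S j)
    | restr (S j :&: S (q j k)) g == f) weight m S (fun j => q j k) Dm j g.
  move=> jm; rewrite /Dm; have [-> _] := sol j jm (map_code f).
  by apply: eq_bigl => g; rewrite (inj_eq map_code_inj).
rewrite (card_homs_root Sc (cert_parent certq) Si De m0 (cert_root certq)) /Dm.
(* The empty map has code 0, so the single entry of the root is cell 0. *)
by rewrite (_ : map_code _ = 0) //; apply: big1 => v _; rewrite ffunE.
Qed.

Lemma dpP s rho : context s -> s a_D =1 (fun=> 0) -> s a_seen =1 (fun=> 0) ->
  0 < m -> wp R W B dp rho s (fun s' => s' 1 0 = hom P G).
Proof.
move=> cs sD ss m0; have [[sk sm _ _] _ _ _ _] := cs.
have bndB j : bound j <= B.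
  by apply: leq_trans (bound_le (leq0n j)) _; rewrite /bound subn0.
have B0 : 0 < B by apply: leq_trans boundB; rewrite expn_gt0 A_gt0.
(* Columns from [m - r] on are final; smaller ones are still zero, as the sums to be accumulated
   there require. *)
pose I r (t : state) := (forall j, j < m -> m - r <= j -> solved t j) /\
  forall j c, j < m - r -> t a_D (c * m + j) = 0 /\ t a_seen (c * m + j) = 0.
apply: wp_seq; apply: (wp_for_frame (I := I)) => //=; rewrite ?sm //.
- split=> [j jm|j c _]; last by rewrite sD ss.
  by rewrite subn0 leqNgt jm.
- move=> r t rm fr [I1 I2].
  have ct : context t.
    apply: context_eq cs => a na; apply: fr; move: na.
    by rewrite !inE !negb_or; do 5 case/andP=> ->; move=> ->.
  have [[tk tm _ _] _ _ _ _] := ct.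
  apply: wp_seq; apply: wp_asg => //=; rewrite tm; first lia.
  set i := m - (r + 1); have im : i < m by lia.
  set t1 := update t _ _ _.
  have t1E a : a != a_i -> t1 a = t a by rewrite /t1 /update => /negPf->.
  have ct1 : context t1.
    by apply: context_eq ct => a na; apply: t1E; apply: contraNneq na => ->.
  have t1i : t1 a_i 0 = i by [].
  have TE rh : ev (Big true (scalar a_k) (t_beta (Var 0))) rh t1 =
      \prod_(0 <= v < k) beta i v.
    rewrite ev_prod (_ : ev (scalar a_k) rh t1 = k); last by rewrite -tk.
    by rewrite big_mkord; apply: eq_bigr => v _; apply: ev_t_beta.
  have wM f : weight_in t1 i f <= bound i.+1 ^ m.
    apply: weight_in_le => // j c /andP[ij jm]; rewrite t1E //.
    by have [] := I1 j jm ltac:(lia) c.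
  apply: (wp_for_frame (I := invariant i t1)).
  + rewrite /= t1E // tk; do ! split=> //.
  + by rewrite TE betaW.
  + exists set0; split=> //.
    * exact: sub0set.
    * move=> c; rewrite big_pred0 => [|f]; last by rewrite inE.
      by rewrite t1E //; have [] := I2 i c ltac:(lia).
    * split=> [f _|c]; rewrite t1E // ?inE.
        by have [] := I2 i (map_code f) ltac:(lia).
      by have [_ ->] := I2 i c ltac:(lia).
  + rewrite TE => x t2 xT fr2 inv.
    have f2 a : a \notin [:: a_x; a_F; a_new; a_D; a_seen] -> t2 a = t1 a.
      exact: fr2.
    apply: (@dp_stepP i t1 x t2 _ (bound i.+1 ^ m)) => //.
    * apply: context_eq ct1 => a na; apply: f2; move: na.
      by rewrite !inE !negb_or; case/and5P=> _ -> -> -> /andP[-> ->].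
    * by rewrite f2.
    * exact: leq_trans xT (betaW im).
    * exact: leq_trans (card_H_bound im) _.
  move=> t2 fr2; rewrite TE => -[seen [sH sx tD _ to]].
  (* Every element of [H i] is produced by some code in range, so the loop has counted all of
     them. *)
  have seenE : seen = H i.
    apply/eqP; rewrite eqEsubset sH; apply/subsetP => f fH.
    by have [x xT xd] := guess_exists im fH; apply: sx fH xT xd.
  have t2D j c : j < m -> j != i -> t2 a_D (c * m + j) = t a_D (c * m + j).
    by move=> jm ji; have [-> _] := to j c jm ji; rewrite t1E.
  (* Weights of sets from [i] on read only columns beyond [i], which this round leaves alone. *)
  have wE j f : i <= j -> weight_in t2 j f = weight_in t j f.
    move=> ij; apply: eq_bigr => j' /andP[jj' _]; apply: t2D => //.
    by rewrite gtn_eqF // (leq_ltn_trans ij).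
  split=> [j jm|j c ji]; last first.
    by rewrite t2D ?(to j c _ _).2; try lia; rewrite t1E; [apply: I2; lia|].
  move=> mj c; case: (eqVneq j i) => [->|ji]; last first.
    have ij : i < j by rewrite ltn_neqAle eq_sym ji /=; lia.
    rewrite t2D //; have [] := I1 j jm ltac:(lia) c.
    move=> -> le; split=> //; apply: eq_bigr => f _.
    by rewrite wE // ltnW.
  have E : t2 a_D (c * m + i) =
      \sum_(f in H i | map_code (restr (shared i) f) == c) weight_in t1 i f.
    by rewrite tD seenE.
  split.
    rewrite E; apply: eq_bigr => f _; rewrite wE //; apply: weight_in_eq.
  rewrite E; apply: leq_trans (card_H_bound im); rewrite -sum_nat_const.
  rewrite big_mkcondr /=; apply: leq_sum => f _; case: ifP => // _.
move=> t fr [sol _].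
have {}sol j : j < m -> solved t j by move=> jm; apply: sol => //; lia.
apply: wp_asg => //=.
  by have [_ le] := sol 0 m0 0; apply: leq_trans le _.
by rewrite /update /= solved_root.
Qed.

End DynamicProgram.

(** * The algorithm *)

(* Arrays 4-7 describe [P], arrays 8-11 describe [G]. *)
Definition program : stmt :=
  read_graph a_k a_P 6 7;;
  read_graph a_n a_G a_nb a_deg;;
  search;;
  dp.

(** The empty pattern has [tau P = 0], so even reading [G] would take too long; its unique
    homomorphism is counted at once. *)
Definition algorithm : prog :=
  If (Get 0 (Const 0)) (compile [::] 0 program) (Set_ 1 (Const 0) (Const 1)).

(** * Adjacency lists in the input *)

Definition adj_lists (n : nat) (e : rel 'I_n) : seq (seq nat) :=
  [seq [seq nat_of_ord v | v <- enum 'I_n & e u v] | u <- enum 'I_n].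

Section AdjacencyLists.

Variables (n : nat) (e : rel 'I_n).

Lemma size_adj_lists : size (adj_lists e) = n.
Proof. by rewrite size_map size_enum_ord. Qed.

Lemma nth_adj_lists (x : 'I_n) : nth [::] (adj_lists e) x =
  [seq nat_of_ord v | v <- enum 'I_n & e x v].
Proof. by rewrite (nth_map x) ?size_enum_ord // nth_ord_enum. Qed.

Lemma mem_adj_lists (x y : 'I_n) :
  (nat_of_ord y \in nth [::] (adj_lists e) x) = e x y.
Proof.
by rewrite nth_adj_lists (mem_map val_inj) mem_filter mem_enum andbT.
Qed.

Lemma size_adj_list (x : 'I_n) :
  size [seq nat_of_ord v | v <- enum 'I_n & e x v] = #|[set v | e x v]|.
Proof. by rewrite size_map cardsE cardE enumT. Qed.

Lemma encodeE : encode e = n :: adjacency_code (adj_lists e).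
Proof.
rewrite /encode /adjacency_code /adj_lists -map_comp; congr (_ :: flatten _).
by apply: eq_map => u /=; rewrite size_adj_list.
Qed.

Lemma adj_listsP l : l \in adj_lists e ->
  [/\ size l <= n, size l <= max_outdeg e & forall y, y \in l -> y < n].
Proof.
case/mapP=> x _ ->; rewrite size_adj_list; split.
- by rewrite -[X in _ <= X]card_ord max_card.
- exact: (leq_bigmax (F := fun x : 'I_n => #|[set v | e x v]|)).
- by move=> y /mapP[v _ ->].
Qed.

Lemma max_adj_lists : \max_(l <- adj_lists e) size l = max_outdeg e.
Proof.
rewrite big_map big_enum /=; apply: eq_bigr => x _; exact: size_adj_list.
Qed.

Lemma size_adjacency_code :
  size (adjacency_code (adj_lists e)) <= n * (max_outdeg e).+1.
Proof.
rewrite size_flatten /shape -map_comp sumnE big_map.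
apply: leq_trans (_ : \sum_(l <- adj_lists e) (max_outdeg e).+1 <= _).
  rewrite big_seq [X in _ <= X]big_seq; apply: leq_sum => l /adj_listsP[_ le _].
  exact: le.
by rewrite big_const_seq count_predT size_adj_lists iter_addn_0 mulnC.
Qed.

Lemma encode_le x : x \in encode e -> x <= n.
Proof.
rewrite encodeE inE => /predU1P[->//|/flattenP[l]].
case/mapP=> l' /adj_listsP[s1 _ H].
by move=> ->; rewrite inE => /predU1P[->//|/H/ltnW].
Qed.

End AdjacencyLists.

Lemma max_outdeg_le k (P : rel 'I_k) : max_outdeg P <= k.
Proof.
by apply/bigmax_leqP => u _; rewrite -[X in _ <= X]card_ord max_card.
Qed.

Lemma tau_decomposition (V : finType) (P : rel V) :
  exists D : dag_tree_decomposition P, width D = tau P.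
Proof. by rewrite /tau; case: ex_minnP => w /boolp.asboolP. Qed.

Lemma tau_le k (P : rel 'I_k) : tau P <= k.
Proof.
have [D <-] := tau_decomposition P; apply/bigmax_leqP => A _.
by rewrite -[X in _ <= X]card_ord max_card.
Qed.

(** A nonempty dag has a source, which lies in some bag. Thus [n <= n ^ tau P], and reading [G] fits
    the time bound. *)
Lemma tau_gt0 k (P : rel 'I_k) : acyclic P -> 0 < k -> 0 < tau P.
Proof.
move=> acP k0; have [D <-] := tau_decomposition P.
have [s sS _] := source_above acP (Ordinal k0).
case: D => N r a tree rN Nsrc Ncov Ninter; rewrite /width /=.
move: sS; rewrite -Ncov => /bigcupP[A AN sA].
rewrite (bigD1 A AN) /= leq_max; apply/orP; left.
by apply/card_gt0P; exists s.
Qed.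

(** * Constants and the final time bound *)

Section Bounds.

Variables d k : nat.

Definition small_bound : nat :=
  cert_space k + num_sets k * k.+1 + cert_base k + d + k.

(** [d.+1 ^ k] bounds the choices among out-neighbours; the factor [k.+1] makes [W] cover the loop
    over the nodes of [P], which is read by the same code as [G]. *)
Definition big_factor : nat := k.+1 * d.+1 ^ k.

(** The exponent [L] in [B = n.+2 ^ L]: the summands make room for [R], [W], the table entries and
    the input positions, in this order. *)
Definition log_bound : nat :=
  small_bound + (big_factor + k) + k * (num_sets k).+1 ^ num_sets k +
  (k * k.+1 + d + 4).

(** 7 is the cost for the empty pattern, [k + 3] that of the initial test, 20 the constant of the
    unit cost; the 2 comes from comparing the bit length of [n + 2] with that of
    [n.+1 * d.+1 * k.+1]. *)
Definition time_factor : nat :=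
  7 + (k + 3) + steps small_bound 1 program * big_factor *
    (20 * (height small_bound program * (log_bound * 2))).

End Bounds.

Lemma elementary_time_factor : elementary time_factor.
Proof.
have eN : elementary (fun _ k => num_sets k) by rewrite /num_sets; elem.
have eR : elementary small_bound.
  rewrite /small_bound /cert_space /cert_base; elem.
have eF : elementary big_factor by rewrite /big_factor; elem.
have eL : elementary log_bound by rewrite /log_bound; elem.
rewrite /time_factor; elem.
  exact: (elementary_steps program eR).
exact: (elementary_height program eR).
Qed.

Lemma leq_expn_n2 n x : x <= n.+2 ^ x.
Proof. exact/ltnW/ltn_expl. Qed.

Section Analysis.

Variables (k n d : nat) (P : rel 'I_k) (G : rel 'I_n).
Hypotheses (acP : acyclic P) (k0 : 0 < k) (maxd : max_outdeg G = d).

Let R := small_bound d k.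
Let X := maxn n 1 ^ tau P.
Let W := big_factor d k * X.
Let L := log_bound d k.
Let B := n.+2 ^ L.
Let s0 := init (encode P ++ encode G).

Lemma X_gt0 : 0 < X.
Proof. by rewrite expn_gt0 leq_maxr. Qed.

Lemma R_le_B : R <= B.
Proof.
apply: leq_trans (leq_expn_n2 n R) _; apply: leq_pexp2l => //.
by rewrite /L /log_bound -/R; lia.
Qed.

Lemma W_le_B : W <= B.
Proof.
apply: leq_trans (_ : n.+2 ^ (big_factor d k + k) <= _); last first.
  by apply: leq_pexp2l => //; rewrite /L /log_bound; lia.
rewrite expnD; apply: leq_mul; first exact: leq_expn_n2.
apply: leq_trans (_ : n.+2 ^ tau P <= _).
  case: (posnP (tau P)) => [t0|t0]; first by rewrite /X t0.
  by rewrite leq_exp2r // geq_max; lia.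
by apply: leq_pexp2l => //; apply: tau_le.
Qed.

Lemma codes_le_B :
  (size (adjacency_code (adj_lists P))).+1 +
  (size (adjacency_code (adj_lists G))).+1 <= B.
Proof.
have := size_adjacency_code P; have := size_adjacency_code G.
have := max_outdeg_le P; rewrite maxd => mP sG sP.
apply: leq_trans (_ : n.+2 ^ (k * k.+1 + d + 4) <= _); last first.
  by apply: leq_pexp2l => //; rewrite /L /log_bound; lia.
have -> : k * k.+1 + d + 4 = (k * k.+1 + d + 3).+1 by lia.
rewrite expnS; apply: leq_trans (_ : n.+2 * (k * k.+1 + d + 3) <= _).
  by nia.
by rewrite leq_mul2l leq_expn_n2 orbT.
Qed.

Lemma n_lt_B : n < B.
Proof.
apply: leq_trans (_ : n.+2 ^ 1 <= _); first by rewrite expn1.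
by apply: leq_pexp2l => //; rewrite /L /log_bound; lia.
Qed.

Lemma k_le_R : k <= R. Proof. by rewrite /R /small_bound; lia. Qed.

Lemma init_bounded : bounded_state B s0.
Proof.
move=> a i _; rewrite /s0 /init; case: eqP => // _.
case: (ltnP i (size (encode P ++ encode G))) => iS; last by rewrite nth_default.
have := mem_nth 0 iS; rewrite mem_cat => /orP[] /encode_le le.
  by apply: leq_trans le (leq_trans k_le_R R_le_B).
by apply: leq_trans le (ltnW n_lt_B).
Qed.

Lemma k_le_W : k <= W.
Proof.
have := X_gt0; have : 0 < d.+1 ^ k by rewrite expn_gt0.
rewrite /W /big_factor; nia.
Qed.

Lemma n_le_W : n <= W.
Proof.
have nX : n <= X.
  apply: leq_trans (leq_maxl n 1) _.
  by rewrite -{1}(expn1 (maxn n 1)) leq_pexp2l ?leq_maxr ?tau_gt0.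
apply: leq_trans nX _; rewrite leq_pmull // /big_factor muln_gt0 /=.
by rewrite expn_gt0.
Qed.

(** At most [w <= tau P] nodes are free and contribute a factor [n], every other node contributes
    [d.+1]. Passing to [maxn n 1] makes the power monotone in its exponent. *)
Lemma prod_beta_le m w q i : certificate P m w q -> w <= tau P -> i < m ->
  \prod_(0 <= v < k) beta n d q i v <= W.
Proof.
move=> cq wt im; rewrite big_mkord.
apply: leq_trans (_ : \prod_(v < k) d.+1 *
    \prod_(v < k | q i v == v.+1) maxn n 1 <= _).
  rewrite [X in _ <= _ * X]big_mkcond -big_split /=; apply: leq_prod => v _.
  rewrite /beta; case: ifP => _; last by rewrite muln1.
  by apply: leq_trans (leq_maxl n 1) _; rewrite leq_pmull.
rewrite !prod_nat_const card_ord /W /big_factor; apply: leq_mul.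
  by rewrite leq_pmull.
rewrite leq_pexp2l ?leq_maxr // (leq_trans _ wt) //.
apply: leq_trans (cert_width cq im); apply: subset_leq_card.
by apply/subsetP => v; rewrite inE.
Qed.

Lemma programP : wp R W B program [::] s0 (fun s' => s' 1 0 = hom P G).
Proof.
have kR := k_le_R; have RB := R_le_B; have WB := W_le_B; have nB := n_lt_B.
have cB := codes_le_B.
have sz1 := size_adj_lists P; have sz2 := size_adj_lists G.
apply: wp_seq.
apply: wp_mono (wp_frame (read_graphP [::] (LL := adj_lists P)
  (rest := encode G) (p0 := 0) _ _ _ _ _ _ _ _ _ _)) _ => //.
- by move=> i; rewrite /s0 [encode P]encodeE /init /= add0n sz1.
- move=> l /adj_listsP[l1 l2 l3]; rewrite sz1.
  by have := max_outdeg_le P; split=> //; lia.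
- by rewrite sz1 k_le_W.
- by rewrite sz1; lia.
- by lia.
move=> s1 [[[s1k s1P _ _ _] s1p] f1].
apply: wp_seq.
apply: wp_mono (wp_frame (read_graphP [::] (LL := adj_lists G) (rest := [::])
  _ s1p _ _ _ _ _ _ _ _)) _ => //.
- move=> i; rewrite f1 // sz2 cats0 -encodeE /s0 [encode P]encodeE /init.
  by rewrite nth_cat [size (_ :: _)]/= add0n ltnNge leq_addr /= addKn.
- by move=> i; rewrite f1.
- by move=> i; rewrite f1.
- by rewrite f1.
- move=> l /adj_listsP[l1 l2 l3]; rewrite sz2; rewrite maxd in l2.
  have dR : d <= R by rewrite /R /small_bound; lia.
  by split=> //; lia.
- by rewrite sz2 n_le_W.
- by rewrite sz2 ltnW.
move=> s2 [[[s2n s2G s2nb s2nb_le s2d] _] f2].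
rewrite sz2 in s2n s2G s2nb s2nb_le; rewrite sz1 in s1k s1P.
have s2k : s2 a_k 0 = k by rewrite f2.
have s2P (u v : 'I_k) : s2 a_P (u * k + v) = P u v.
  by rewrite f2 // s1P // mem_adj_lists.
(* An optimal decomposition only guarantees that the search succeeds; the dynamic program runs on
   the certificate found, of width [w <= tau P]. *)
have [D wD] := tau_decomposition P.
have [q0 [cq0 q0b]] := decomposition_certificate acP D; rewrite wD in cq0.
apply: wp_seq.
apply: wp_mono (wp_frame (searchP W [::] s2k s2P _ (tau_le P) cq0 q0b _ _ _ RB))
  _ => //; try by rewrite /R /small_bound; lia.
  by rewrite f2 // f1.
move=> s3 [[s3m [w wt cq]] f3].
have mR : num_sets k <= R by rewrite /R /small_bound /cert_base; lia.
apply: (dpP acP cq (nbl := nth [::] (adj_lists G)) (d := d)) => //.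
- by move=> x y; rewrite mem_adj_lists.
- move=> x; case: (ltnP x (size (adj_lists G))) => xn.
    by have /adj_listsP[_ + _] := mem_nth [::] xn; rewrite maxd.
  by rewrite nth_default.
- rewrite -expnM.
  apply: leq_trans (_ : n.+2 ^ (k * (num_sets k).+1 ^ num_sets k) <= _).
    case: (posnP (k * (num_sets k).+1 ^ num_sets k)) => [->|e0] //.
    by rewrite leq_exp2r.
  by apply: leq_pexp2l => //; rewrite /L /log_bound; lia.
- by move=> i im; apply: prod_beta_le cq wt im.
- split; first by split=> //; rewrite f3 // s2d max_adj_lists.
  + by [].
  + by move=> u v; rewrite f3.
  + by move=> x y; rewrite f3 // s2G // mem_adj_lists.
  + split=> [x j jx|x]; rewrite f3 //.
    by rewrite s2nb.
- by move=> i; rewrite f3 // f2 // f1.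
- by move=> i; rewrite f3 // f2 // f1.
Qed.

Lemma algorithm_time : exists2 t,
  outputs_in algorithm (encode P ++ encode G) (hom P G) t
  & t <= time_factor d k * (bits (n.+1 * d.+1 * k.+1) * X).
Proof.
have [sf val] := programP.
have W0 : 0 < W by apply: leq_trans k_le_W.
have L0 : 0 < L by rewrite /L /log_bound; lia.
set h := height R program.
have h0 : 0 < h by [].
have B2 : 1 < B.
  by rewrite (leq_trans (_ : 1 < n.+2)) // -{1}(expn1 n.+2) leq_pexp2l.
have [s' [t [ex le out]]] := compile_correct B2 R_le_B W_le_B
  (leqnn h) (isT : wf program) init_bounded sf.
set bt := bits (n.+1 * d.+1 * k.+1).
have bB : bits (B ^ h) <= h * (L * 2) * bt.
  apply: leq_trans (bits_exp _ h0) _.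
  rewrite -mulnA leq_mul2l; apply/orP; right.
  apply: leq_trans (bits_exp _ L0) _.
  rewrite -mulnA leq_mul2l; apply/orP; right.
  rewrite bits_leP ?muln_gt0 //.
  have lt := ltn_2bits (n.+1 * d.+1 * k.+1); rewrite -/bt in lt.
  have : 2 ^ bt * 2 <= 2 ^ (2 * bt).
    by rewrite -expnSr leq_exp2l //; have := bits_gt0 (n.+1 * d.+1 * k.+1); lia.
  nia.
have st : steps R W program <= steps R 1 program * W.
  exact: steps_unnested.
have s00 : s0 0 0 = k by rewrite /s0 encodeE.
have bk : bits k <= k.+1.
  rewrite bits_leP //; apply: ltn_trans (ltn_expl k (isT : 1 < 2)) _.
  by rewrite ltn_exp2l.
exists (cost s0 (Get 0 (Const 0)) + t).
  exists s'; last by rewrite out.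
  by apply: exec_if_true ex; rewrite /= s00 -lt0n.
have bt0 : 0 < bt by [].
have c0 : cost s0 (Get 0 (Const 0)) <= k + 3.
  by rewrite /= s00; have -> : bits 0 = 1 by []; lia.
have Xb0 : 0 < bt * X by rewrite muln_gt0 X_gt0.
have tb : t <=
    steps R 1 program * big_factor d k * (20 * (h * (L * 2))) * (bt * X).
  apply: leq_trans le _.
  apply: leq_trans (leq_mul st (leq_mul (leqnn 20) bB)) _.
  by rewrite /W; lia.
rewrite /time_factor -/R -/h -/L.
set T := steps R 1 program * _ * _ in tb *.
by nia.
Qed.

End Analysis.

Lemma empty_pattern n (P : rel 'I_0) (G : rel 'I_n) :
  outputs_in algorithm (encode P ++ encode G) (hom P G) 7.
Proof.
have -> : hom P G = 1.
  rewrite /hom; transitivity #|[set: {ffun 'I_0 -> 'I_n}]|.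
    by apply: eq_card => f; rewrite !inE; apply/forallP => -[].
  by rewrite cardsT card_ffun !card_ord expn0.
pose s := init (encode P ++ encode G).
have s00 : s 0 0 = 0 by rewrite /s encodeE.
exists (update s 1 0 1) => //.
have -> : 7 = cost s (Get 0 (Const 0)) + 4 by rewrite /= s00.
by apply: exec_if_false; [exact: s00 | exact: exec_set].
Qed.

(* [maxn n 1] is [n] except for the empty graph, for which no algorithm could
   run in time proportional to [n ^ tau P] = 0. *)
Theorem theorem3p5 :
  exists (A : prog) (f : nat -> nat -> nat) (c : nat),
    computable2 f /\
    forall (k n d : nat) (P : rel 'I_k) (G : rel 'I_n),
      acyclic P -> acyclic G -> max_outdeg G = d ->
      computes_within A (encode P ++ encode G) (hom P G)
        (f d k * soft_bound c n d k (maxn n 1 ^ tau P)).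
Proof.
have [C HC] := elementary_time_factor.
(* The exponent 1 suffices: one bit length is paid per instruction, and all other factors in [d] and
   [k] go into the tower. *)
exists algorithm, (fun d k => tower (C + d + k)), 1.
split; first exact: computable_tower.
move=> k n d P G acP _ maxd.
have le : time_factor d k * (bits (n.+1 * d.+1 * k.+1) * maxn n 1 ^ tau P) <=
    tower (C + d + k) * soft_bound 1 n d k (maxn n 1 ^ tau P).
  apply: leq_mul => //; rewrite /soft_bound mul1n !expn1.
  by rewrite -[k.+1 * _ * _]mulnA leq_pmull.
case: (posnP k) => [k0|k0]; last first.
  have [t H tt] := algorithm_time acP k0 maxd.
  by exists t => //; apply: leq_trans tt le.
subst k; exists 7; first exact: empty_pattern.
apply: leq_trans le; rewrite /time_factor.
have : 0 < bits (n.+1 * d.+1 * 1) * maxn n 1 ^ tau P.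
  by rewrite muln_gt0 /= expn_gt0 leq_maxr.
by set T := steps _ _ _ * _ * _; nia.
Qed.
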